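(* Let $d\ge 1$ be an integer and let $\psi \in C^\infty(\overline{Q_d})$ be such that all of its derivatives are $2\pi$-periodic in each variable and $\psi$ has zero average. Let $k$ be a non-positive integer and $m$ a non-negative integer. (1) If $d > -2k+4m$, then $$C(m, k, d)\int_{Q_d} |\psi(x)|^2 \omega(x)^{k-2m}\, dx \leq \int_{Q_d} |\Delta^m \psi(x)|^2 \omega(x)^{k}\, dx,\qquad\text{where } C(m, k, d) := \prod_{i=0}^{m-1} R(k-2i, d).$$ (2) If $d > -2k+4m+2$, then $$\widetilde{C}(m, k, d)\int_{Q_d} |\psi(x)|^2 \omega(x)^{k-(2m+1)}\, dx \leq \int_{Q_d} |\nabla(\Delta^m \psi)(x)|^2 \omega(x)^{k}\, dx,\qquad\text{where } \widetilde{C}(m, k, d) := H(k, d)\prod_{i=0}^{m-1}R(k-2i-1, d).$$ Here $H$ and $R$ are the explicit constants defined in the context.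
   Context: $Q_d := (-\pi,\pi)^d$. A map $\psi:\overline{Q_d}\to\mathbb{C}$ is $2\pi$-periodic in each variable if for every $i$ its values at $x_i=-\pi$ and $x_i=\pi$ (other coordinates fixed) agree; ''all derivatives'' includes $\psi$ itself; zero average means $\int_{Q_d}\psi\,dx=0$. $\nabla$ and $\Delta=\sum_{i}\partial_{x_i}^2$ are the usual gradient and Laplacian, $\Delta^0$ is the identity, and $\omega(x) := \sum_{j=1}^d \sin^2(x_j/2)$. Empty products equal $1$. Constants, for a non-positive integer $k$: Hardy constant $H(k,d)$ (for $d>-2k+2$): $$H(k, d)^{-1} := \sum_{j=0}^{-k} d^j A_1(k + j, d) \prod_{i=0}^{j-1}A_2(k +i, d) + d^{-k}\prod_{i=0}^{-k}A_2(k+i, d),$$ $$A_1(k, d) := \frac{16}{(d+2k-2)^2},\qquad A_2(k, d) := \frac{3d+2k-2}{d(d+2k-2)}.$$ Hardy–Rellich constant $HR(k,d)$: $$HR(k, d)^{-1} := \sum_{j=0}^{-k} d^j B_1(k + j, d) \prod_{i=0}^{j-1}B_2(k + i, d) + d^{-k}\prod_{i=0}^{-k}B_2(k+i, d),$$ $$B_1(k, d) := \frac{16}{(d-2k)^2},\qquad B_2(k, d) := \frac{3d-2k+4}{d(d-2k)}.$$ Rellich constant $R(k,d)$ (for $d>-2k+4$): $$R(k, d) := \frac{(d-2k)^2(d+2k-4)^2}{256\Big(1+HR(k, d)^{-1}\big(d\, C_1(k/2, d)+d\, C_2(k/2, d)H(k, d)^{-1}\big)\Big)},$$ where $$C_1(\alpha,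 d) := \frac{2\beta(d-2\beta + 2\alpha-1)}{d},\qquad C_2(\alpha, d) := \frac{\beta(d+4\beta-4\alpha)(d+2\alpha-2)(2\beta-2\alpha+1)}{2d},$$ $$\beta=\beta(\alpha,d) := \tfrac18\Big(-4 + 8\alpha + \sqrt{2}\sqrt{d^2 -4d + 16\alpha^2 -16 \alpha + 8}\Big).$$ *)

(* Defs.v *)
From HB Require Import structures.
From mathcomp Require Import all_boot all_order all_algebra.
From mathcomp Require Import all_classical all_reals all_analysis.
From mathcomp Require Import complex.

Set Implicit Arguments.
Unset Strict Implicit.
Unset Printing Implicit Defensive.

Import Order.TTheory GRing.Theory Num.Theory.
Import numFieldNormedType.Exports.

Local Open Scope classical_set_scope.
Local Open Scope ring_scope.
Local Open Scope complex_scope.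

(* Lebesgue measure on R^n, for R^n = n.-tuple R with its product
   sigma-algebra: a point mass for n = 0, then the image of the product measure
   lebesgue_measure \x lebesgue_tuple n under consing. *)
Section LebesgueTuple.
Context {R : realType}.
Local Notation mR := (measurableTypeR R).

Definition cons_tuple n (p : mR * n.-tuple mR) : n.+1.-tuple mR :=
  [tuple of p.1 :: p.2].

Lemma measurable_cons_tuple n : measurable_fun setT (@cons_tuple n).
Proof. exact: measurable_cons measurable_fst measurable_snd. Qed.

Section Step.
Variables (n : nat) (mu : {sigma_finite_measure set (n.-tuple mR) -> \bar R}).

Let prod_mu : {measure set (mR * n.-tuple mR) -> \bar R} :=
  ((@lebesgue_measure R : {sigma_finite_measure set mR -> \bar R}) \x mu)%E.

Definition lebesgue_cons : set (n.+1.-tuple mR) -> \bar R :=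
  pushforward prod_mu (@cons_tuple n).

Let pre_measurable A : measurable A -> measurable (@cons_tuple n @^-1` A).
Proof.
by move=> mA; rewrite -[X in measurable X]setTI; exact: measurable_cons_tuple.
Qed.

Let lebesgue_cons0 : lebesgue_cons set0 = 0%E.
Proof. by rewrite /lebesgue_cons /pushforward preimage_set0 measure0. Qed.

Let lebesgue_cons_ge0 A : (0 <= lebesgue_cons A)%E.
Proof. by rewrite /lebesgue_cons /pushforward; apply: measure_ge0. Qed.

Let lebesgue_cons_sigma_additive : semi_sigma_additive lebesgue_cons.
Proof.
move=> F mF tF mUF; rewrite /lebesgue_cons /pushforward preimage_bigcup.
apply: measure_semi_sigma_additive.
- by move=> i; exact: pre_measurable.
- apply/trivIsetP => /= i j _ _ ij; rewrite -preimage_setI.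
  by move/trivIsetP : tF => /(_ _ _ _ _ ij) ->//; rewrite preimage_set0.
- by rewrite -preimage_bigcup; exact: pre_measurable.
Qed.

HB.instance Definition _ := isMeasure.Build _ _ _ lebesgue_cons
  lebesgue_cons0 lebesgue_cons_ge0 lebesgue_cons_sigma_additive.

Let lebesgue_cons_sigma_finite : sigma_finite setT lebesgue_cons.
Proof.
pose g (t : n.+1.-tuple mR) : mR * n.-tuple mR := (thead t, [tuple of behead t]).
have mg : measurable_fun setT g.
  apply: measurable_fun_pair; first exact: measurable_tnth.
  exact: measurable_behead.
have gK p : g (cons_tuple p) = p.
  by case: p => x t; congr (_, _); apply/val_inj.
have /sigma_finiteP[F [TF ndF Foo]] := sigma_finiteT (@lebesgue_measure R).
have /sigma_finiteP[G [TG ndG Goo]] := sigma_finiteT mu.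
exists (fun i => g @^-1` (F i `*` G i)).
  apply/esym/seteqP; split=> // t _.
  have [k _ Fk] : (\bigcup_i F i) (g t).1 by rewrite -TF.
  have [l _ Gl] : (\bigcup_i G i) (g t).2 by rewrite -TG.
  exists (maxn k l) => //; split.
    by move: Fk; exact/subsetPset/ndF/leq_maxl.
  by move: Gl; exact/subsetPset/ndG/leq_maxr.
move=> i; have [mF Fi] := Foo i; have [mG Gi] := Goo i.
have mFG : measurable (F i `*` G i) by exact: measurableX.
split; first by rewrite -[X in measurable X]setTI; exact: mg.
rewrite /= /lebesgue_cons /pushforward.
suff -> : @cons_tuple n @^-1` (g @^-1` (F i `*` G i)) = F i `*` G i.
  by rewrite /prod_mu/= product_measure1E// lte_mul_pinfty// ge0_fin_numE.
rewrite -[LHS]/((g \o @cons_tuple n) @^-1` _).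
by have -> : g \o @cons_tuple n = id by apply/funext => p; exact: gK.
Qed.

HB.instance Definition _ := Measure_isSigmaFinite.Build _ _ _ lebesgue_cons
  lebesgue_cons_sigma_finite.

End Step.

Fixpoint lebesgue_tuple n : {sigma_finite_measure set (n.-tuple mR) -> \bar R} :=
  if n is n'.+1 then lebesgue_cons (lebesgue_tuple n') else \d_ [tuple].

End LebesgueTuple.
Arguments lebesgue_tuple R n : clear implicits.

Section Calculus.
Context {R : realType} {d : nat}.
Implicit Types (u g : 'rV[R]_d -> R) (f : 'rV[R]_d -> R[i]).
Implicit Types (x : 'rV[R]_d) (i : 'I_d) (w : seq 'I_d).

(* Points of R^d are row vectors; `tuple_row` transports them from the tuples
   carrying Lebesgue measure. *)
Definition tuple_row (t : d.-tuple (measurableTypeR R)) : 'rV[R]_d :=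
  \row_j tnth t j.

Definition cube : set 'rV[R]_d := [set x | forall i, - pi < x 0 i < pi].
Definition closed_cube : set 'rV[R]_d := [set x | forall i, - pi <= x 0 i <= pi].

Definition cube_integral (F : 'rV[R]_d -> \bar R) : \bar R :=
  (\int[lebesgue_tuple R d]_(t in tuple_row @^-1` cube) F (tuple_row t))%E.

Definition cube_integralC f : R[i] :=
  (\int[lebesgue_tuple R d]_(t in tuple_row @^-1` cube) complex.Re (f (tuple_row t)))
  +i*
  (\int[lebesgue_tuple R d]_(t in tuple_row @^-1` cube) complex.Im (f (tuple_row t))).

Definition partial i u x : R := 'D_(delta_mx 0 i) u x.

(* iter_partial [:: i1; ...; ip] u = d_i1 (... (d_ip u)) *)
Definition iter_partial w u : 'rV[R]_d -> R := foldr partial u w.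

Definition continuous_extension u g : Prop :=
  {within closed_cube, continuous g} /\ {in cube, g =1 u}.

(* C^oo on the closed cube: all iterated partial derivatives exist in the open
   cube and extend continuously to the closed one, with u itself as extension
   of order zero. The values of u off the closed cube play no role. *)
Definition smooth_closed_cube u : Prop :=
  {within closed_cube, continuous u} /\
  forall w,
    (forall i x, cube x -> derivable (iter_partial w u) x (delta_mx 0 i)) /\
    (exists g, continuous_extension (iter_partial w u) g).

Definition set_coord x i (a : R) : 'rV[R]_d :=
  \row_j (if j == i then a else x 0 j).

Definition periodic_closed_cube g : Prop :=
  forall i x, closed_cube x -> g (set_coord x i (- pi)) = g (set_coord x i pi).

(* The boundary values of a derivative are those of its (unique) continuous
   extension; w = [::] gives the periodicity of u itself. *)
Definition periodic_derivatives u : Prop :=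
  forall w g, continuous_extension (iter_partial w u) g ->
    periodic_closed_cube g.

(* Derivatives of complex-valued functions are taken componentwise. *)
Definition partialC i f x : R[i] :=
  partial i (fun y => complex.Re (f y)) x +i* partial i (fun y => complex.Im (f y)) x.

Definition laplacian f x : R[i] := \sum_(i < d) partialC i (partialC i f) x.

Definition iter_laplacian m f : 'rV[R]_d -> R[i] := iter m laplacian f.

Definition sqmod (z : R[i]) : R := ComplexField.Normc.normc z ^+ 2.

Definition sqmod_gradient f x : R := \sum_(i < d) sqmod (partialC i f x).

Definition omega x : R := \sum_(j < d) sin (x 0 j / 2) ^+ 2.

End Calculus.

(* The integer k is meant to be non-positive, so `|k|%N is -k. *)
Section Constants.
Variable R : realType.
Implicit Types (k : int) (d : nat) (alpha : R).

Definition A1 k d : R := 16 / (d%:R + 2 * k%:~R - 2) ^+ 2.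
Definition A2 k d : R :=
  (3 * d%:R + 2 * k%:~R - 2) / (d%:R * (d%:R + 2 * k%:~R - 2)).

Definition B1 k d : R := 16 / (d%:R - 2 * k%:~R) ^+ 2.
Definition B2 k d : R :=
  (3 * d%:R - 2 * k%:~R + 4) / (d%:R * (d%:R - 2 * k%:~R)).

Definition hardy k d : R :=
  (\sum_(0 <= j < `|k|%N.+1)
      d%:R ^+ j * A1 (k + j%:Z) d * \prod_(0 <= i < j) A2 (k + i%:Z) d
   + d%:R ^+ `|k|%N * \prod_(0 <= i < `|k|%N.+1) A2 (k + i%:Z) d)^-1.

Definition hardy_rellich k d : R :=
  (\sum_(0 <= j < `|k|%N.+1)
      d%:R ^+ j * B1 (k + j%:Z) d * \prod_(0 <= i < j) B2 (k + i%:Z) d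
   + d%:R ^+ `|k|%N * \prod_(0 <= i < `|k|%N.+1) B2 (k + i%:Z) d)^-1.

Definition beta_cst alpha d : R :=
  8^-1 * (- 4 + 8 * alpha +
    Num.sqrt 2 * Num.sqrt
      (d%:R ^+ 2 - 4 * d%:R + 16 * alpha ^+ 2 - 16 * alpha + 8)).

Definition C1 alpha d : R :=
  let beta := beta_cst alpha d in
  2 * beta * (d%:R - 2 * beta + 2 * alpha - 1) / d%:R.
Definition C2 alpha d : R :=
  let beta := beta_cst alpha d in
  beta * (d%:R + 4 * beta - 4 * alpha) * (d%:R + 2 * alpha - 2) *
    (2 * beta - 2 * alpha + 1) / (2 * d%:R).

Definition rellich k d : R :=
  (d%:R - 2 * k%:~R) ^+ 2 * (d%:R + 2 * k%:~R - 4) ^+ 2 /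
  (256 * (1 + (hardy_rellich k d)^-1 *
     (d%:R * C1 (k%:~R / 2) d + d%:R * C2 (k%:~R / 2) d * (hardy k d)^-1))).

Definition C_even (m : nat) k d : R :=
  \prod_(0 <= i < m) rellich (k - 2 * i%:Z) d.

Definition C_odd (m : nat) k d : R :=
  hardy k d * \prod_(0 <= i < m) rellich (k - 2 * i%:Z - 1) d.

End Constants.

(* Main.v *)
Require Import Defs.
From mathcomp Require Import all_boot all_order all_algebra.
From mathcomp Require Import all_classical all_reals all_analysis.
From mathcomp Require Import complex measurable_realfun.
From mathcomp Require Import ring lra zify.

(** The proof treats the real and the imaginary part of psi separately and
replaces the singular weight omega by w = (1 - del) omega + del d, 0 < del < 1.
Then w is bounded below, omega <= w <= d, and 1 / w increases to 1 / omega. It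
turns out that all inequalities hold for w with constants that do not depend on
del ([hardy_scalar], [rellich_scalar]), so one passage to the limit, by monotone
convergence, is made at the very end ([limit_ineq]).

For fixed del everything follows from integration by parts on the torus
([cint_partial]). The gradient of omega is half of F = (sin x_1, ..., sin x_d),
with div F = d - 2 omega and, by Cauchy-Schwarz,
|F|^2 = 4 sum_j (sin^2 - sin^4)(x_j / 2) <= 4 (omega - omega^2 / d).

Hardy. Integrating div (u^2 w^(-n-1) F) = 0 and completing a square gives
  int u^2 w^(-n-1) <= A1 int |grad u|^2 w^(-n) + A2 int u^2 w^(-n)
([hardy_step]). As w <= d, this can be iterated down to n = 0, where the
Poincare inequality with constant 1 ends the chain; the constants obey the
recursion of 1 / H ([hardy_chain]). The Poincare inequality is the
one-dimensional one of Wirtinger, proved by comparison with a tangent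
([wirtinger]), and tensorised by the subadditivity of the variance
([variance_tensor]).

Rellich. Integrating div (u w^(-n-1) grad u) = 0, removing the first-order term
with a multiple of the Hardy field, and applying the Hardy inequality and Young
gives
  rho^2 int u^2 w^(-n-2) <= int |Lap u|^2 w^(-n) + 2 rho err int u^2 w^(-n-1),
where rho^2 is the numerator of the constant R ([rellich_step]). The last
integral is of the same kind as the left-hand side for n - 1, so by induction it
is at most half of d / (HR H) times int |Lap u|^2 w^(-n) ([rellich_chain]).
This leaves two statements about the constants: that d / (HR H) grows fast
enough for the induction ([cross_step]), and that rho err <= C2 and C1 >= 0, so
that the resulting constant is at least R ([rellich_bound]).

The theorem then follows by applying the Rellich inequality to
u, Lap u, Lap^2 u, ... and, in the second part, the Hardy inequality to Lap^m u
([even_ineq], [odd_ineq]). *)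

Import Order.TTheory GRing.Theory Num.Theory.
Import numFieldNormedType.Exports.
Local Open Scope classical_set_scope.
Local Open Scope ring_scope.

(** * The constants *)

Section Arithmetic.

(** The shape shared by the reciprocals of H and HR. Since an estimate at
exponent k is reduced to one at exponent k + 1, it is used only through the
recursion [chain_sumS]. *)
Definition chain_sum {R : realType} (x : R) (a b : int -> R) (k : int) : R :=
  \sum_(0 <= j < `|k|%N.+1) x ^+ j * a (k + j%:Z) * \prod_(0 <= i < j) b (k + i%:Z)
  + x ^+ `|k|%N * \prod_(0 <= i < `|k|%N.+1) b (k + i%:Z).

Lemma chain_sum0 (R : realType) (x : R) (a b : int -> R) :
  chain_sum x a b 0 = a 0 + b 0.
Proof.
by rewrite /chain_sum !absz0 !big_nat1 (@big_geq _ _ _ 0 0)// !expr0 !mul1r mulr1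
  !addr0.
Qed.

Lemma chain_sumS (R : realType) (x : R) (a b : int -> R) (n : nat) :
  chain_sum x a b (- n.+1%:Z) =
  a (- n.+1%:Z) + x * b (- n.+1%:Z) * chain_sum x a b (- n%:Z).
Proof.
rewrite /chain_sum !abszN !absz_nat.
have shift (j : nat) : - n.+1%:Z + j.+1%:Z = - n%:Z + j%:Z by lia.
rewrite [in X in X + _]big_nat_recl// (@big_geq _ _ _ 0 0)// expr0 mul1r mulr1
  addr0 -addrA; congr (_ + _).
rewrite mulrDr mulr_sumr; congr (_ + _).
  apply: eq_big_nat => j _.
  rewrite big_nat_recl//= addr0 shift exprS.
  under eq_bigr => i _ do rewrite shift.
  by ring.
rewrite big_nat_recl//= addr0.
under eq_bigr => i _ do rewrite shift.
by rewrite exprS; ring.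
Qed.

Variable R : realType.
Implicit Types (d n : nat).

Let castN n : (- n%:Z)%:~R = - n%:R :> R.
Proof. by rewrite mulrNz -pmulrn. Qed.

Lemma hardyV k d : (hardy R k d)^-1 = chain_sum d%:R (A1 R ^~ d) (A2 R ^~ d) k.
Proof. by rewrite /hardy invrK. Qed.

Lemma hardy_rellichV k d :
  (hardy_rellich R k d)^-1 = chain_sum d%:R (B1 R ^~ d) (B2 R ^~ d) k.
Proof. by rewrite /hardy_rellich invrK. Qed.

Lemma A1N n d : A1 R (- n%:Z) d = 16 / (d%:R - 2 * n%:R - 2) ^+ 2.
Proof. by rewrite /A1 castN mulrN. Qed.

Lemma A2N n d : A2 R (- n%:Z) d =
  (3 * d%:R - 2 * n%:R - 2) / (d%:R * (d%:R - 2 * n%:R - 2)).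
Proof. by rewrite /A2 castN mulrN. Qed.

Lemma B1N n d : B1 R (- n%:Z) d = 16 / (d%:R + 2 * n%:R) ^+ 2.
Proof. by rewrite /B1 castN mulrN opprK. Qed.

Lemma B2N n d : B2 R (- n%:Z) d =
  (3 * d%:R + 2 * n%:R + 4) / (d%:R * (d%:R + 2 * n%:R)).
Proof. by rewrite /B2 castN mulrN opprK. Qed.

Lemma hardyVS n d : (hardy R (- n.+1%:Z) d)^-1 =
  A1 R (- n.+1%:Z) d + d%:R * A2 R (- n.+1%:Z) d * (hardy R (- n%:Z) d)^-1.
Proof. by rewrite !hardyV chain_sumS. Qed.

Lemma hardy_rellichVS n d : (hardy_rellich R (- n.+1%:Z) d)^-1 =
  B1 R (- n.+1%:Z) d + d%:R * B2 R (- n.+1%:Z) d * (hardy_rellich R (- n%:Z) d)^-1.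
Proof. by rewrite !hardy_rellichV chain_sumS. Qed.

Let natlt (a b : nat) : (a < b)%N -> a%:R + 1 <= b%:R :> R.
Proof. by rewrite -(ler_nat R) -[in X in X <= _]addn1 natrD. Qed.

(** Crude, but both reciprocals enter the Rellich estimate only through a lower
bound of their product, where powers of 3 / d are enough. Each step of the
recursion multiplies by d A2 >= 1. *)
Lemma hardyV_ge n d : (2 * n + 2 < d)%N -> 3 / d%:R <= (hardy R (- n%:Z) d)^-1.
Proof.
elim: n => [|n IH] hd.
  have /natlt {}hd : (2 < d)%N by lia.
  rewrite oppr0 hardyV chain_sum0 -[0]oppr0 A1N A2N !mulr0 !subr0.
  set x : R := d%:R in hd *.
  have h1 : 0 <= 16 / (x - 2) ^+ 2 by rewrite divr_ge0// sqr_ge0.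
  suff : 3 / x <= (3 * x - 2) / (x * (x - 2)) by lra.
  rewrite ler_pdivrMr; last lra.
  rewrite mulrAC ler_pdivlMr; last by nra.
  nra.
have {}IH := IH ltac:(lia).
have hn : 0 <= n%:R :> R by [].
have hx := natlt _ _ hd; rewrite natrD natrM -[n.+1%:R]natr1 in hx.
rewrite hardyVS A1N A2N -[n.+1%:R]natr1.
set x : R := d%:R in hx IH *; set y : R := n%:R in hx hn *.
have h1 : 0 <= 16 / (x - 2 * (y + 1) - 2) ^+ 2 by rewrite divr_ge0// sqr_ge0.
set h := (hardy _ _ _)^-1 in IH *.
suff : 1 <= x * ((3 * x - 2 * (y + 1) - 2) / (x * (x - 2 * (y + 1) - 2))).
  move=> h2; apply: (le_trans IH); apply: (le_trans (y := 1 * h));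
    first by rewrite mul1r.
  apply: (le_trans (ler_wpM2r _ h2)); last by rewrite lerDr.
  by apply: le_trans IH; rewrite divr_ge0//; lra.
rewrite mulrA ler_pdivlMr; last by rewrite mulr_gt0//; lra.
rewrite mul1r ler_pM2l; lra.
Qed.

Lemma hardy_gt0 n d : (2 * n + 2 < d)%N -> 0 < hardy R (- n%:Z) d.
Proof.
move=> hd; rewrite -invr_gt0; apply: lt_le_trans (hardyV_ge _ _ hd).
by rewrite divr_gt0// ltr0n; lia.
Qed.

Lemma hardy_rellichV_ge n d : (0 < d)%N ->
  3 / d%:R <= (hardy_rellich R (- n%:Z) d)^-1.
Proof.
move=> hd; have := natlt _ _ hd; rewrite add0r => hx.
elim: n => [|n IH].
  rewrite oppr0 hardy_rellichV chain_sum0 -[0]oppr0 B1N B2N !mulr0 !addr0.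
  set x : R := d%:R in hx *.
  have h1 : 0 <= 16 / x ^+ 2 by rewrite divr_ge0// sqr_ge0.
  suff : 3 / x <= (3 * x + 4) / (x * x) by lra.
  rewrite ler_pdivrMr; last lra.
  rewrite mulrAC ler_pdivlMr; last by nra.
  nra.
have hn : 0 <= n%:R :> R by [].
rewrite hardy_rellichVS B1N B2N -[n.+1%:R]natr1.
set x : R := d%:R in hx IH *; set y : R := n%:R in hn *.
have h1 : 0 <= 16 / (x + 2 * (y + 1)) ^+ 2 by rewrite divr_ge0// sqr_ge0.
set h := (hardy_rellich _ _ _)^-1 in IH *.
suff : 1 <= x * ((3 * x + 2 * (y + 1) + 4) / (x * (x + 2 * (y + 1)))).
  move=> h2; apply: (le_trans IH); apply: (le_trans (y := 1 * h));
    first by rewrite mul1r.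
  apply: (le_trans (ler_wpM2r _ h2)); last by rewrite lerDr.
  by apply: le_trans IH; rewrite divr_ge0//; lra.
rewrite mulrA ler_pdivlMr; last by rewrite mulr_gt0//; lra.
rewrite mul1r ler_pM2l; lra.
Qed.

(** [rho n d ^+ 2] is the constant of the Euclidean Rellich inequality with
weight |x|^(-2n), rescaled to omega ~ |x|^2 / 4; it is the numerator of
R(-n, d). *)
Definition rho (n d : nat) : R := (d%:R + 2 * n%:R) * (d%:R - 2 * n%:R - 4) / 16.
(** The coefficient of the lower-order mass that the torus adds to the Euclidean
Rellich computation: one part comes from the second derivatives of the
weight, the other from the Hardy inequality. *)
Definition err (n d : nat) : R :=
  (n%:R + 1) * (d%:R - n%:R - 2) / (2 * d%:R)
  + (d%:R - 2 * n%:R - 4) * (3 * d%:R - 2 * n%:R - 4) / (16 * d%:R).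
(** d / (HR(-n, d) H(-n, d)), whose half bounds the lower-order mass by the
Laplacian: see [rellich_chain]. *)
Definition cross (n d : nat) : R :=
  d%:R * (hardy_rellich R (- n%:Z) d)^-1 * (hardy R (- n%:Z) d)^-1.

Lemma cross_ge n d : (2 * n + 2 < d)%N -> 9 / d%:R <= cross n d.
Proof.
move=> hd; have d0 : 0 < d%:R :> R by rewrite ltr0n; lia.
have h1 := hardyV_ge _ _ hd.
have h2 := hardy_rellichV_ge n d ltac:(lia).
rewrite /cross; rewrite (_ : 9 / d%:R = d%:R * (3 / d%:R) * (3 / d%:R)); last first.
  by field; rewrite gt_eqF.
have h3 : 0 <= 3 / d%:R :> R by rewrite divr_ge0// ltW.
apply: ler_pM => //.
by rewrite ler_pM2l.
Qed.

Lemma cross_ge0 n d : (2 * n + 2 < d)%N -> 0 <= cross n d.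
Proof. by move=> hd; apply: le_trans (cross_ge _ _ hd); rewrite divr_ge0. Qed.

Lemma rho_gt0 n d : (2 * n + 4 < d)%N -> 0 < rho n d.
Proof.
move=> /natlt; rewrite natrD natrM => hx; have hn : 0 <= n%:R :> R by [].
by rewrite /rho divr_gt0// mulr_gt0//; lra.
Qed.

Lemma err_ge0 n d : (2 * n + 4 < d)%N -> 0 <= err n d.
Proof.
move=> /natlt; rewrite natrD natrM => hx; have hn : 0 <= n%:R :> R by [].
by rewrite /err addr_ge0// divr_ge0// ?mulr_ge0//; lra.
Qed.

Lemma cross0 d : (4 < d)%N -> (hardy R 0 d)^-1 <= cross 0 d / 2.
Proof.
move=> hd; have h := hardyV_ge 0 d ltac:(lia).
have d0 : 1 <= d%:R :> R by rewrite ler1n; lia.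
rewrite /cross oppr0 in h *.
have h0 : 0 <= (hardy R 0 d)^-1 by apply: le_trans h; rewrite divr_ge0//; lra.
suff : 2 <= d%:R * (hardy_rellich R 0 d)^-1 by move=> ?; nra.
have := hardy_rellichV_ge 0 d ltac:(lia); rewrite oppr0 ler_pdivrMr; lra.
Qed.

(** The polynomial inequality behind [cross_step], with D = d - 2 and q = n + 1,
once denominators are cleared and [cross] is replaced by its lower bound
9 / d. *)
Let step_poly (D q : R) : 1 <= q -> 2 * q + 3 <= D ->
  256 * (D + 2) ^+ 2 * (D + 2 * q + 2) <=
  9 / 2 * ((9 * D ^+ 2 + 42 * D + 40 - 12 * q - 4 * q ^+ 2) * (D + 2 * q)
     - 2 * (3 * D ^+ 2 + 4 * D - 4 * q ^+ 2) * (D + 2 * q + 2))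
   * (D - 2 * q) * (D + 2 * q).
Proof.
move=> hq hD; rewrite -subr_ge0.
(* Shifted to the corner q = 1, D = 2q + 3, the polynomial has only positive
   coefficients. *)
pose r := q - 1; pose m := D - 2 * q - 3.
have r0 : 0 <= r by rewrite /r; lra.
have m0 : 0 <= m by rewrite /m; lra.
have -> : q = 1 + r by rewrite /r; ring.
have -> : D = 3 + m + 2 * (1 + r) by rewrite /m /r; ring.
have mon i j : 0 <= m ^+ i * r ^+ j by rewrite mulr_ge0// exprn_ge0.
move: (mon 0%N 1%N) (mon 0%N 2%N) (mon 0%N 3%N) (mon 0%N 4%N) (mon 1%N 0%N)
  (mon 1%N 1%N) (mon 1%N 2%N) (mon 1%N 3%N) (mon 1%N 4%N) (mon 2%N 0%N) (mon
  2%N 1%N) (mon 2%N 2%N) (mon 2%N 3%N) (mon 3%N 0%N) (mon 3%N 1%N) (mon 3%N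
  2%N) (mon 4%N 0%N) (mon 4%N 1%N) (mon 5%N 0%N).
clearbody m r; clear; lra.
Qed.

(** The induction step of [rellich_chain] turns a bound by c at n into a bound by
d / rho^2 (1 + 2 rho err c) at n + 1. Both factors of [cross] grow with n,
by d A2 and d B2, and their product beats 2 d err / rho by a margin that also
absorbs the term d / rho^2. *)
Lemma cross_step n d : (2 * n + 6 < d)%N ->
  d%:R / rho n d ^+ 2 * (1 + 2 * rho n d * err n d * (cross n d / 2))
  <= cross n.+1 d / 2.
Proof.
move=> hd.
have X9 := cross_ge n d ltac:(lia).
have h0 := hardyV_ge n d ltac:(lia).
have g0 := hardy_rellichV_ge n d ltac:(lia).
have h1 := natlt _ _ hd; rewrite natrD natrM in h1; have hn : 0 <= n%:R :> R by [].
have {h0}h0 : 0 <= (hardy R (- n%:Z) d)^-1 by apply: le_trans h0; rewrite divr_ge0.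
have {g0}g0 : 0 <= (hardy_rellich R (- n%:Z) d)^-1 by apply: le_trans g0;
  rewrite divr_ge0.
have hcr : cross n.+1 d >= (d%:R * A2 R (- n.+1%:Z) d) * (d%:R * B2 R (- n.+1%:Z)
  d) * cross n d.
  rewrite /cross hardyVS hardy_rellichVS.
  have a0 : 0 <= A1 R (- n.+1%:Z) d by rewrite /A1 divr_ge0// sqr_ge0.
  have b0 : 0 <= B1 R (- n.+1%:Z) d by rewrite /B1 divr_ge0// sqr_ge0.
  have a20 : 0 <= d%:R * A2 R (- n.+1%:Z) d.
    by rewrite A2N -[n.+1%:R]natr1 mulr_ge0// divr_ge0 ?mulr_ge0//; lra.
  have b20 : 0 <= d%:R * B2 R (- n.+1%:Z) d.
    by rewrite B2N -[n.+1%:R]natr1 mulr_ge0// divr_ge0 ?mulr_ge0//; lra.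
  move: a0 b0 a20 b20 h0 g0.
  set a := A1 _ _ _; set b := B1 _ _ _; set a' := d%:R * A2 _ _ _.
  set b' := d%:R * B2 _ _ _; set h := (hardy _ _ _)^-1;
    set g := (hardy_rellich _ _ _)^-1.
  move=> a0 b0 a20 b20 h0 g0.
  rewrite (_ : a' * b' * (d%:R * g * h) = d%:R * (b' * g) * (a' * h)); last by ring.
  have d0 : 0 <= d%:R :> R by [].
  have bg0 : 0 <= b' * g by exact: mulr_ge0.
  apply: ler_pM; [exact: mulr_ge0|exact: mulr_ge0| |by rewrite lerDr].
  by rewrite ler_wpM2l// lerDr.
apply: (@le_trans _ _ (d%:R * A2 R (- n.+1%:Z) d * (d%:R * B2 R (- n.+1%:Z) d) *
  cross n d / 2)); last by rewrite ler_pM2r// invr_gt0.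
rewrite A2N B2N -[n.+1%:R]natr1 /rho /err.
move: X9 {hcr h0 g0}; set X := cross n d.
have dE : d%:R = (d%:R - 2) + 2 :> R by ring.
pose D : R := d%:R - 2; pose q : R := n%:R + 1.
have -> : d%:R = D + 2 by rewrite /D; ring.
have -> : n%:R = q - 1 by rewrite /q; ring.
have hq : 1 <= q by rewrite /q; lra.
have hD : 2 * q + 3 <= D by rewrite /q /D; lra.
move: D q hq hD {dE h1 hn} => D q hq hD X9.
have P0 : 0 < D + 2 * q by lra.
have M0 : 0 < D - 2 * q by lra.
rewrite [X in X <= _](_ : _ = 256 * (D + 2) / ((D + 2 * q) * (D - 2 * q)) ^+ 2 +
   (3 * D ^+ 2 + 4 * D - 4 * q ^+ 2) / ((D + 2 * q) * (D - 2 * q)) * X); last first.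
  field; rewrite ?mulf_neq0 ?gt_eqF//; lra.
rewrite [X in _ <= X](_ : _ =
   (3 * D + 4 - 2 * q) * (3 * D + 10 + 2 * q) / ((D - 2 * q) * (D + 2 * q + 2)) /
     2 * X); last first.
  field; rewrite ?mulf_neq0 ?gt_eqF//; lra.
rewrite -lerBrDr -mulrBl.
set c := (X in _ <= X * _).
have cE : c = ((9 * D ^+ 2 + 42 * D + 40 - 12 * q - 4 * q ^+ 2) * (D + 2 * q)
     - 2 * (3 * D ^+ 2 + 4 * D - 4 * q ^+ 2) * (D + 2 * q + 2)) /
     (2 * (D - 2 * q) * (D + 2 * q) * (D + 2 * q + 2)).
  by rewrite /c; field; rewrite ?mulf_neq0 ?gt_eqF//; lra.
have sp := step_poly D q hq hD.
set N := (X in c = X / _) in cE.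
rewrite -/N in sp.
have key : 256 * (D + 2) / ((D + 2 * q) * (D - 2 * q)) ^+ 2 <= c * (9 / (D + 2)).
  rewrite cE -subr_ge0.
  rewrite [X in 0 <= X](_ : _ =
   (9 / 2 * N * (D - 2 * q) * (D + 2 * q) - 256 * (D + 2) ^+ 2 * (D + 2 * q + 2)) /
   (((D + 2 * q) * (D - 2 * q)) ^+ 2 * (D + 2) * (D + 2 * q + 2))); last first.
    by field; rewrite ?mulf_neq0 ?gt_eqF//; lra.
  by rewrite divr_ge0 ?subr_ge0// !mulr_ge0 ?sqr_ge0//; lra.
have e0 : 0 < 9 / (D + 2) by rewrite divr_gt0//; lra.
have l0 : 0 <= 256 * (D + 2) / ((D + 2 * q) * (D - 2 * q)) ^+ 2.
  by rewrite divr_ge0 ?sqr_ge0//; lra.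
have c0 : 0 <= c by rewrite -(pmulr_lge0 _ e0); exact: le_trans key.
by apply: (le_trans key); rewrite ler_wpM2l.
Qed.

(** With D = d - 2 and q = n + 1, the square root s in beta = (s - 4q) / 8 lies
between D + 2q and 2D. The lower bound gives rho err <= C2, the upper one
C1 >= 0, so the denominator of R(-n, d) dominates 1 + rho err cross. *)
Lemma rellich_bound n d : (2 * n + 4 < d)%N ->
  0 <= rellich R (- n%:Z) d /\
  rellich R (- n%:Z) d * (1 + 2 * rho n d * err n d * (cross n d / 2)) <= rho n d
    ^+ 2.
Proof.
move=> hd.
have h0 := hardyV_ge n d ltac:(lia).
have g0 := hardy_rellichV_ge n d ltac:(lia).
have r0 := rho_gt0 n d hd; have e0 := err_ge0 n d hd.
have h1 := natlt _ _ hd; rewrite natrD natrM in h1; have hn : 0 <= n%:R :> R by [].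
have {h0}h0 : 0 <= (hardy R (- n%:Z) d)^-1 by apply: le_trans h0; rewrite divr_ge0.
have {g0}g0 : 0 <= (hardy_rellich R (- n%:Z) d)^-1 by apply: le_trans g0;
  rewrite divr_ge0.
rewrite /rellich /cross.
set h := (hardy R _ _)^-1 in h0 *; set g := (hardy_rellich R _ _)^-1 in g0 *.
set c1 := C1 _ _; set c2 := C2 _ _.
have [c10 c2E] : 0 <= c1 /\ rho n d * err n d <= c2.
  rewrite /c1 /c2 /C1 /C2 castN; set b := beta_cst _ _.
  pose D : R := d%:R - 2; pose q : R := n%:R + 1.
  have dE : d%:R = D + 2 by rewrite /D; ring.
  have nE : n%:R = q - 1 by rewrite /q; ring.
  have hq : 1 <= q by rewrite /q; lra.
  have hD : 2 * q + 1 <= D by rewrite /q /D; lra.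
  pose s := Num.sqrt (2 * D ^+ 2 + 8 * q ^+ 2).
  have bE : b = (s - 4 * q) / 8.
    rewrite /b /beta_cst -sqrtrM// -[X in _ + Num.sqrt X](_ : 2 * D ^+ 2 + 8 * q
      ^+ 2 = _).
      by rewrite -/s nE; field.
    by rewrite dE nE; field.
  have s0 : 0 <= s by exact: sqrtr_ge0.
  have ss : s ^+ 2 = 2 * D ^+ 2 + 8 * q ^+ 2.
    by rewrite sqr_sqrtr// addr_ge0// mulr_ge0// sqr_ge0.
  have sl : D + 2 * q <= s by rewrite -ler_sqr ?nnegrE; nra.
  have su : s <= 2 * D by rewrite -ler_sqr ?nnegrE; nra.
  rewrite bE /rho /err dE nE; split.
    apply: divr_ge0; last lra.
    by apply: mulr_ge0; lra.
  clearbody s; clear -hq hD sl s0.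
  set lhs := (X in X <= _); set rhs := (X in _ <= X).
  have -> : lhs = ((D + 2 * q) * (D - 2 * q) * (3 * D ^+ 2 + 4 * D - 4 * q ^+ 2))
    / (256 * (D + 2)).
    by rewrite /lhs; field; lra.
  have -> : rhs = (s - 4 * q) * (2 * D + s) * (D + 1 - q) * s / (128 * (D + 2)).
    by rewrite /rhs; field; lra.
  rewrite ler_pdivrMr; last lra.
  rewrite [X in _ <= X](_ : _ = 2 * ((s - 4 * q) * (2 * D + s) * (D + 1 - q) *
    s)); last by field; lra.
  apply: (@le_trans _ _ (2 * ((D - 2 * q) * (3 * D + 2 * q) * (D + 1 - q) * (D +
    2 * q)))).
    have t : 0 <= (D - 2 * q) * (D + 2 * q) by apply: mulr_ge0; lra.
    rewrite [X in X <= _](_ : _ = ((D - 2 * q) * (D + 2 * q)) * (3 * D ^+ 2 + 4 *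
      D - 4 * q ^+ 2)); last by ring.
    rewrite [X in _ <= X](_ : _ = ((D - 2 * q) * (D + 2 * q)) * (2 * ((3 * D + 2
      * q) * (D + 1 - q)))); last by ring.
    by rewrite ler_wpM2l//; nra.
  rewrite ler_pM2l//.
  apply: ler_pM => //; [|lra|].
    by apply: mulr_ge0; [apply: mulr_ge0|]; lra.
  apply: ler_wpM2r; first lra.
  by apply: ler_pM; lra.
clearbody c1 c2 h g.
have d0 : 0 <= d%:R :> R by [].
have Q0 : 0 < 1 + g * (d%:R * c1 + d%:R * c2 * h).
  have c20 : 0 <= c2 := le_trans (mulr_ge0 (ltW r0) e0) c2E.
  have : 0 <= g * (d%:R * c1 + d%:R * c2 * h).
    by apply: mulr_ge0 => //; apply: addr_ge0; do ?apply: mulr_ge0.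
  by lra.
rewrite castN mulrN opprK.
have -> : (d%:R + 2 * n%:R) ^+ 2 * (d%:R + - (2 * n%:R) - 4) ^+ 2 /
   (256 * (1 + g * (d%:R * c1 + d%:R * c2 * h))) =
   rho n d ^+ 2 / (1 + g * (d%:R * c1 + d%:R * c2 * h)).
  by rewrite /rho; field; rewrite gt_eqF.
split; first by rewrite divr_ge0 ?sqr_ge0// ltW.
rewrite mulrAC ler_pdivrMr// ler_wpM2l ?sqr_ge0// lerD2l.
rewrite (_ : 2 * rho n d * err n d * (d%:R * g * h / 2) = g * (d%:R * (rho n d *
  err n d) * h)); last by field.
rewrite ler_wpM2l//.
apply: (@le_trans _ _ (d%:R * c2 * h)); last by rewrite lerDr mulr_ge0.
by rewrite ler_wpM2r// ler_wpM2l.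
Qed.

End Arithmetic.

(** * Integrals of bounded measurable functions *)

Set Implicit Arguments.
Unset Strict Implicit.
Unset Printing Implicit Defensive.

Section BoundedMeasurable.
Context {R : realType}.

(** Bounded measurable functions are integrable on every set of finite measure,
and are stable under products and partial integration; this removes all
integrability side conditions below. *)
Definition bmeas {dT} {T : measurableType dT} (f : T -> R) : Prop :=
  measurable_fun setT f /\ exists M, forall x, `|f x| <= M.

Section Closure.
Context {dT} {T : measurableType dT}.
Implicit Types f g : T -> R.

Lemma bmeas_cst (c : R) : bmeas (fun _ : T => c).
Proof. by split; [exact: measurable_cst|exists `|c|]. Qed.

Lemma bmeasD f g : bmeas f -> bmeas g -> bmeas (fun x => f x + g x).
Proof.
move=> [mf [M fM]] [mg [N gN]]; split; first exact: measurable_funD.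
by exists (M + N) => x; rewrite (le_trans (ler_normD _ _))// lerD.
Qed.

Lemma bmeasM f g : bmeas f -> bmeas g -> bmeas (fun x => f x * g x).
Proof.
move=> [mf [M fM]] [mg [N gN]]; split; first exact: measurable_funM.
by exists (M * N) => x; rewrite normrM ler_pM.
Qed.

Lemma bmeasN f : bmeas f -> bmeas (fun x => - f x).
Proof.
move=> [mf [M fM]]; split; first exact: measurableT_comp.
by exists M => x; rewrite normrN.
Qed.

Lemma bmeasB f g : bmeas f -> bmeas g -> bmeas (fun x => f x - g x).
Proof. by move=> bf bg; apply: bmeasD => //; exact: bmeasN. Qed.

Lemma bmeasZ (c : R) f : bmeas f -> bmeas (fun x => c * f x).
Proof. by move=> bf; apply: bmeasM => //; exact: bmeas_cst. Qed.

Lemma bmeas_sqr f : bmeas f -> bmeas (fun x => f x ^+ 2).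
Proof. by move=> bf; under eq_fun do rewrite expr2; exact: bmeasM. Qed.

Lemma bmeas_sum (I : Type) (r : seq I) (F : I -> T -> R) :
  (forall i, bmeas (F i)) -> bmeas (fun x => \sum_(i <- r) F i x).
Proof.
move=> bF; elim: r => [|i r IH].
  by under eq_fun do rewrite big_nil; exact: bmeas_cst.
by under eq_fun do rewrite big_cons; exact: bmeasD.
Qed.

Lemma bmeas_comp {dU} {U : measurableType dU} f (h : U -> T) :
  bmeas f -> measurable_fun setT h -> bmeas (f \o h).
Proof.
move=> [mf [M fM]] mh; split; first exact: measurableT_comp.
by exists M => x /=.
Qed.

End Closure.

Section Integral.
Context {dT} {T : measurableType dT} (mu : {measure set T -> \bar R}).
Context (A : set T) (mA : measurable A) (muA : (mu A < +oo)%E).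
Implicit Types f g : T -> R.

Lemma bmeas_integrable f : bmeas f -> mu.-integrable A (EFin \o f).
Proof.
move=> [mf [M fM]]; apply: measurable_bounded_integrable => //.
  exact: measurable_funS mf.
by exists M; split => [|x Mx y _ /=]; rewrite ?num_real// (le_trans (fM y))// ltW.
Qed.

Lemma RintD f g : bmeas f -> bmeas g ->
  \int[mu]_(x in A) (f x + g x) = \int[mu]_(x in A) f x + \int[mu]_(x in A) g x.
Proof. by move=> bf bg; apply: RintegralD => //; exact: bmeas_integrable. Qed.

Lemma RintB f g : bmeas f -> bmeas g ->
  \int[mu]_(x in A) (f x - g x) = \int[mu]_(x in A) f x - \int[mu]_(x in A) g x.
Proof. by move=> bf bg; apply: RintegralB => //; exact: bmeas_integrable. Qed.

Lemma RintZ (c : R) f : bmeas f ->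
  \int[mu]_(x in A) (c * f x) = c * \int[mu]_(x in A) f x.
Proof. by move=> bf; apply: RintegralZl => //; exact: bmeas_integrable. Qed.

Lemma le_Rint f g : bmeas f -> bmeas g -> (forall x, A x -> f x <= g x) ->
  \int[mu]_(x in A) f x <= \int[mu]_(x in A) g x.
Proof. by move=> bf bg fg; apply: le_Rintegral => //; exact: bmeas_integrable. Qed.

Lemma Rint_sum (I : Type) (r : seq I) (F : I -> T -> R) :
  (forall i, bmeas (F i)) ->
  \int[mu]_(x in A) (\sum_(i <- r) F i x) = \sum_(i <- r) \int[mu]_(x in A) F i x.
Proof.
move=> bF; elim: r => [|i r IH].
  rewrite big_nil; under eq_Rintegral do rewrite big_nil.
  by rewrite Rintegral_cst// mul0r.
rewrite big_cons -IH -RintD//; last exact: bmeas_sum.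
by apply: eq_Rintegral => x _; rewrite big_cons.
Qed.

Lemma Rint_sqrB f (c : R) : bmeas f ->
  \int[mu]_(x in A) ((f x - c) ^+ 2) =
  \int[mu]_(x in A) (f x ^+ 2) - 2 * c * (\int[mu]_(x in A) f x)
  + c ^+ 2 * fine (mu A).
Proof.
move=> bf; under eq_Rintegral => x _.
  rewrite (_ : _ ^+ 2 = f x ^+ 2 - 2 * c * f x + c ^+ 2); last by ring.
  over.
have b2 : bmeas (fun x => f x ^+ 2) by exact: bmeas_sqr.
have bZ : bmeas (fun x => 2 * c * f x) by exact: bmeasZ.
rewrite RintD; [|exact: bmeasB|exact: bmeas_cst].
by rewrite RintB// RintZ// Rintegral_cst.
Qed.

(** Cauchy-Schwarz against the constant 1, read off the variance of f. *)
Lemma Rint_sqr_le f : bmeas f -> 0 < fine (mu A) ->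
  (\int[mu]_(x in A) f x) ^+ 2 <= fine (mu A) * \int[mu]_(x in A) (f x ^+ 2).
Proof.
move=> bf A0; set m := fine _ in A0 *; set i := \int[mu]_(x in A) f x.
have : 0 <= \int[mu]_(x in A) ((f x - i / m) ^+ 2).
  by apply: Rintegral_ge0 => x _; exact: sqr_ge0.
rewrite Rint_sqrB// -/m -/i; set j := \int[mu]_(x in A) _.
rewrite (_ : _ - _ + _ = j - i ^+ 2 / m); last by field; rewrite gt_eqF.
by rewrite subr_ge0 ler_pdivrMr// mulrC.
Qed.

End Integral.

Section Product.
Context {d1 d2} {T1 : measurableType d1} {T2 : measurableType d2}.
Context (m1 : {sigma_finite_measure set T1 -> \bar R}).
Context (m2 : {sigma_finite_measure set T2 -> \bar R}).
Context (A1 : set T1) (A2 : set T2) (mA1 : measurable A1) (mA2 : measurable A2).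
Context (A1oo : (m1 A1 < +oo)%E) (A2oo : (m2 A2 < +oo)%E).
Context (f : T1 * T2 -> R) (bf : bmeas f).

Lemma bmeas_pair1 x : bmeas (fun y => f (x, y)).
Proof. exact: (bmeas_comp bf (measurable_pair1 x)). Qed.

Lemma bmeas_pair2 y : bmeas (fun x => f (x, y)).
Proof. exact: (bmeas_comp bf (measurable_pair2 y)). Qed.

Lemma product_lty : ((m1 \x m2) (A1 `*` A2) < +oo)%E.
Proof. by rewrite product_measure1E// lte_mul_pinfty// ge0_fin_numE. Qed.

Let fA : T1 * T2 -> \bar R := (EFin \o f) \_ (A1 `*` A2).

Let fA_int : (m1 \x m2)%E.-integrable setT fA.
Proof.
apply/integrable_restrict => //; first exact: measurableX.
rewrite setTI; apply: bmeas_integrable => //; first exact: measurableX.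
exact: product_lty.
Qed.

Let rint1 x : (\int[m2]_(y in A2) (f (x, y))%:E)%E =
  (\int[m2]_(y in A2) f (x, y))%:E.
Proof.
rewrite fineK//; apply: integrable_fin_num => //.
by apply: (bmeas_integrable mA2 A2oo); exact: bmeas_pair1.
Qed.

Let rint2 y : (\int[m1]_(x in A1) (f (x, y))%:E)%E =
  (\int[m1]_(x in A1) f (x, y))%:E.
Proof.
rewrite fineK//; apply: integrable_fin_num => //.
by apply: (bmeas_integrable mA1 A1oo); exact: bmeas_pair2.
Qed.

Lemma Rint_product1 : \int[(m1 \x m2)%E]_(z in A1 `*` A2) f z =
  \int[m1]_(x in A1) (\int[m2]_(y in A2) f (x, y)).
Proof.
congr fine; rewrite integral_mkcond -/fA -(integral12_prod_meas1 fA_int).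
rewrite [RHS]integral_mkcond; apply: eq_integral => x _.
rewrite /fubini_F patchE; case: ifPn => xA.
  rewrite -rint1 [RHS]integral_mkcond; apply: eq_integral => y _.
  by rewrite /fA !patchE in_setX xA.
apply: integral0_eq => y _.
by rewrite /fA patchE in_setX (negbTE xA).
Qed.

Lemma Rint_product2 : \int[(m1 \x m2)%E]_(z in A1 `*` A2) f z =
  \int[m2]_(y in A2) (\int[m1]_(x in A1) f (x, y)).
Proof.
congr fine; rewrite integral_mkcond -/fA -(integral21_prod_meas1 fA_int).
rewrite [RHS]integral_mkcond; apply: eq_integral => y _.
rewrite /fubini_G patchE; case: ifPn => yA.
  rewrite -rint2 [RHS]integral_mkcond; apply: eq_integral => x _.
  by rewrite /fA !patchE in_setX yA andbT.
apply: integral0_eq => x _.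
by rewrite /fA patchE in_setX (negbTE yA) andbF.
Qed.

End Product.

Section ProductMeasurable.
Context {d1 d2} {T1 : measurableType d1} {T2 : measurableType d2}.

(** Tonelli applies to f + M >= 0 and shows measurability; subtracting the
constant does the rest. *)
Lemma bmeas_Rint1 (m2 : {sigma_finite_measure set T2 -> \bar R})
  (A2 : set T2) (mA2 : measurable A2) (A2oo : (m2 A2 < +oo)%E)
  (f : T1 * T2 -> R) (bf : bmeas f) :
  bmeas (fun x => \int[m2]_(y in A2) f (x, y)).
Proof.
have [mf [M fM]] := bf.
split; last first.
  exists (M * fine (m2 A2)) => x.
  have bx : bmeas (fun y => f (x, y)) by exact: bmeas_pair1.
  apply: le_trans (le_normr_Rintegral mA2 (bmeas_integrable mA2 A2oo bx)) _.
  rewrite -Rintegral_cst//; apply: le_Rint => //; last exact: bmeas_cst.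
  split; first by apply: measurableT_comp => //; case: bx.
  by exists M => y; rewrite normr_id.
pose g : T1 * T2 -> \bar R := fun z => ((f z + M) * \1_A2 z.2)%:E.
have g0 z : (0 <= g z)%E.
  rewrite lee_fin mulr_ge0// -lerBlDr sub0r.
  by have := fM z; rewrite ler_norml => /andP[].
have mg : measurable_fun setT g.
  apply/measurable_EFinP; apply: measurable_funM; first exact: measurable_funD.
  by apply: measurableT_comp => //; exact: measurable_indic.
have mG := measurable_fun_fubini_tonelli_F (m2 := m2) g mg g0.
rewrite [X in measurable_fun _ X](_ : _ =
  (fun x => fine (fubini_F m2 g x) - M * fine (m2 A2))).
  apply: measurable_funB; last exact: measurable_cst.
  exact: measurableT_comp.
apply/funext => x; apply/eqP; rewrite eq_sym subr_eq -Rintegral_cst//.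
have bx : bmeas (fun y => f (x, y)) by exact: bmeas_pair1.
rewrite -RintD//; last exact: bmeas_cst.
apply/eqP; congr fine; rewrite [RHS]integral_mkcond; apply: eq_integral => y _.
rewrite /g patchE /= indicE; case: ifPn => _; by rewrite ?mulr1 ?mulr0.
Qed.

Lemma bmeas_Rint2 (m1 : {sigma_finite_measure set T1 -> \bar R})
  (A1 : set T1) (mA1 : measurable A1) (A1oo : (m1 A1 < +oo)%E)
  (f : T1 * T2 -> R) (bf : bmeas f) :
  bmeas (fun y => \int[m1]_(x in A1) f (x, y)).
Proof.
have [mf [M fM]] := bf.
split; last first.
  exists (M * fine (m1 A1)) => y.
  have bx : bmeas (fun x => f (x, y)) by exact: bmeas_pair2.
  apply: le_trans (le_normr_Rintegral mA1 (bmeas_integrable mA1 A1oo bx)) _.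
  rewrite -Rintegral_cst//; apply: le_Rint => //; last exact: bmeas_cst.
  split; first by apply: measurableT_comp => //; case: bx.
  by exists M => x; rewrite normr_id.
pose g : T1 * T2 -> \bar R := fun z => ((f z + M) * \1_A1 z.1)%:E.
have g0 z : (0 <= g z)%E.
  rewrite lee_fin mulr_ge0// -lerBlDr sub0r.
  by have := fM z; rewrite ler_norml => /andP[].
have mg : measurable_fun setT g.
  apply/measurable_EFinP; apply: measurable_funM; first exact: measurable_funD.
  by apply: measurableT_comp => //; exact: measurable_indic.
have mG := measurable_fun_fubini_tonelli_G (m1 := m1) g mg g0.
rewrite [X in measurable_fun _ X](_ : _ =
  (fun y => fine (fubini_G m1 g y) - M * fine (m1 A1))).
  apply: measurable_funB; last exact: measurable_cst.
  exact: measurableT_comp.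
apply/funext => y; apply/eqP; rewrite eq_sym subr_eq -Rintegral_cst//.
have bx : bmeas (fun x => f (x, y)) by exact: bmeas_pair2.
rewrite -RintD//; last exact: bmeas_cst.
apply/eqP; congr fine; rewrite [RHS]integral_mkcond; apply: eq_integral => x _.
rewrite /g patchE /= indicE; case: ifPn => _; by rewrite ?mulr1 ?mulr0.
Qed.

End ProductMeasurable.

End BoundedMeasurable.

(** * Lebesgue measure on the box *)

Section TupleIntegral.
Context {R : realType}.
Local Notation mR := (measurableTypeR R).

Definition leb : {sigma_finite_measure set mR -> \bar R} := @lebesgue_measure R.
Definition side : set mR := [set s | - pi < s < pi].
Definition box n : set (n.-tuple mR) := [set t | forall i, - pi < tnth t i < pi].

Definition int1 (h : mR -> R) : R := \int[leb]_(s in side) h s.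
Arguments box n : clear implicits.

Definition intb n (f : n.-tuple mR -> R) : R :=
  \int[lebesgue_tuple R n]_(t in box n) f t.

Lemma side_itv : side = `]- pi, pi[%classic.
Proof. by apply/seteqP; split=> s; rewrite /side /= in_itv. Qed.

Lemma measurable_side : measurable side.
Proof. by rewrite side_itv; exact: measurable_itv. Qed.

Lemma leb_side : leb side = (2 * pi)%:E.
Proof.
rewrite side_itv /leb /= lebesgue_measure_itv/= lte_fin gtrN ?pi_gt0//.
by rewrite -EFinB opprK mulr2n mulrDl mul1r.
Qed.

Lemma leb_side_lty : (leb side < +oo)%E.
Proof. by rewrite leb_side ltry. Qed.

Lemma measurable_box n : measurable (box n).
Proof.
rewrite (_ : box n = \bigcap_(i in [set: 'I_n]) ((fun t => tnth t i) @^-1` side)).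
  apply: fin_bigcap_measurable => // i _; rewrite -[X in measurable X]setTI.
  by apply: measurable_tnth => //; exact: measurable_side.
by apply/seteqP; split => t ht i => [_|]; apply: ht.
Qed.

Arguments measurable_box n : clear implicits.

Lemma box_cons n : @Defs.cons_tuple R n @^-1` box n.+1 = side `*` box n.
Proof.
apply/seteqP; split=> -[s t] /=.
  move=> h; split; first by have := h ord0; rewrite tnth0.
  by move=> i; have := h (lift ord0 i); rewrite tnthS.
by move=> [/= hs ht] i; case: (unliftP ord0 i) => [j ->|->]; rewrite ?tnthS ?tnth0.
Qed.

Let pushforwardE n (A : set (n.+1.-tuple mR)) : lebesgue_tuple R n.+1 A =
  (leb \x lebesgue_tuple R n)%E (@Defs.cons_tuple R n @^-1` A).
Proof. by []. Qed.

Let lebesgue_tuple0 (A : set (0.-tuple mR)) : lebesgue_tuple R 0 A = \d_([tuple]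
  : 0.-tuple mR) A.
Proof. by []. Qed.

Lemma box0 : box 0 = setT.
Proof. by apply/seteqP; split => // t _ []. Qed.

Lemma box_lty n : (lebesgue_tuple R n (box n) < +oo)%E.
Proof.
elim: n => [|n IH]; first by rewrite lebesgue_tuple0 diracE ltry.
rewrite pushforwardE box_cons; apply: product_lty => //.
- exact: measurable_side.
- exact: measurable_box.
- exact: leb_side_lty.
Qed.

Lemma box_mass n : fine (lebesgue_tuple R n (box n)) = (2 * pi) ^+ n.
Proof.
elim: n => [|n IH].
  by rewrite lebesgue_tuple0 diracE expr0 box0 mem_set.
rewrite pushforwardE box_cons product_measure1E.
- rewrite [X in fine X](_ : _ = (2 * pi)%:E * (lebesgue_tuple R n (box n)))%E;
  last first.
    by rewrite -leb_side.
  by rewrite fineM// ?IH ?exprS// ge0_fin_numE// box_lty.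
- exact: measurable_side.
- exact: measurable_box.
Qed.

Lemma intb_prod n (f : n.+1.-tuple mR -> R) : bmeas f ->
  intb f = \int[(leb \x lebesgue_tuple R n)%E]_(z in side `*` box n)
    f (Defs.cons_tuple z).
Proof.
move=> bf; congr fine; rewrite -box_cons.
have bfc := bmeas_comp bf (@measurable_cons_tuple R n).
rewrite -[RHS](@integral_pushforward _ _ _ _ R (@Defs.cons_tuple R n)
  (@measurable_cons_tuple R n) (leb \x lebesgue_tuple R n)%E (box n.+1) (EFin \o
    f))//.
- by case: bf => mf _; exact/measurable_EFinP.
- rewrite box_cons; apply: bmeas_integrable => //.
    by apply: measurableX; [exact: measurable_side|exact: measurable_box].
  by apply: product_lty; [exact: measurable_side|exact: measurable_box
    |exact: leb_side_lty|exact: box_lty].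
- exact: measurable_box.
Qed.

Lemma bmeas_cons1 n (f : n.+1.-tuple mR -> R) s : bmeas f ->
  bmeas (fun t => f (Defs.cons_tuple (s, t))).
Proof.
by move=> bf; exact: (bmeas_pair1 (bmeas_comp bf (@measurable_cons_tuple R n)) s).
Qed.

Lemma bmeas_cons2 n (f : n.+1.-tuple mR -> R) t : bmeas f ->
  bmeas (fun s => f (Defs.cons_tuple (s, t))).
Proof.
by move=> bf; exact: (bmeas_pair2 (bmeas_comp bf (@measurable_cons_tuple R n)) t).
Qed.

Lemma bmeas_intb n (f : n.+1.-tuple mR -> R) : bmeas f ->
  bmeas (fun s => intb (fun t => f (Defs.cons_tuple (s, t)))).
Proof.
move=> bf; have bfc := bmeas_comp bf (@measurable_cons_tuple R n).
exact: (bmeas_Rint1 (measurable_box n) (box_lty n) bfc).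
Qed.

Lemma bmeas_int1 n (f : n.+1.-tuple mR -> R) : bmeas f ->
  bmeas (fun t => int1 (fun s => f (Defs.cons_tuple (s, t)))).
Proof.
move=> bf; have bfc := bmeas_comp bf (@measurable_cons_tuple R n).
exact: (bmeas_Rint2 measurable_side leb_side_lty bfc).
Qed.

Lemma intb_cons1 n (f : n.+1.-tuple mR -> R) : bmeas f ->
  intb f = int1 (fun s => intb (fun t => f (Defs.cons_tuple (s, t)))).
Proof.
move=> bf; rewrite intb_prod//.
have bfc := bmeas_comp bf (@measurable_cons_tuple R n).
by rewrite (Rint_product1 measurable_side (measurable_box n) leb_side_lty
  (box_lty n) bfc).
Qed.

Lemma intb_cons2 n (f : n.+1.-tuple mR -> R) : bmeas f ->
  intb f = intb (fun t => int1 (fun s => f (Defs.cons_tuple (s, t)))).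
Proof.
move=> bf; rewrite intb_prod//.
have bfc := bmeas_comp bf (@measurable_cons_tuple R n).
by rewrite (Rint_product2 measurable_side (measurable_box n) leb_side_lty
  (box_lty n) bfc).
Qed.

Definition set_tnth n (t : n.-tuple mR) (i : 'I_n) (s : mR) : n.-tuple mR :=
  [tuple (if j == i then s else tnth t j) | j < n].

Lemma set_tnth0 n (s0 : mR) (t : n.-tuple mR) s :
  set_tnth (Defs.cons_tuple (s0, t)) ord0 s = Defs.cons_tuple (s, t).
Proof.
apply: eq_from_tnth => j; rewrite tnth_mktuple.
by case: (unliftP ord0 j) => [k ->|->]; rewrite ?eqxx ?tnth0 ?tnthS.
Qed.

Lemma set_tnthS n (s0 : mR) (t : n.-tuple mR) i s :
  set_tnth (Defs.cons_tuple (s0, t)) (lift ord0 i) s = Defs.cons_tuple (s0,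
    set_tnth t i s).
Proof.
apply: eq_from_tnth => j; rewrite tnth_mktuple.
case: (unliftP ord0 j) => [k ->|->]; last by rewrite !tnth0.
by rewrite !tnthS tnth_mktuple (inj_eq lift_inj).
Qed.

Lemma box_consP n s t : side s -> box n t -> box n.+1 (Defs.cons_tuple (s, t)).
Proof. by move=> hs ht; have : (side `*` box n) (s, t) by [];
  rewrite -box_cons. Qed.

Lemma side0 : side 0.
Proof. by rewrite /side /= oppr_lt0 pi_gt0. Qed.

(** Fubini in the i-th coordinate, in the form used to integrate by parts: it is
enough to know the sign of the integral over the lines parallel to the i-th
axis. *)
Lemma intb_ge0_slice n (f : n.-tuple mR -> R) (i : 'I_n) : bmeas f ->
  (forall t, box n t -> 0 <= int1 (fun s => f (set_tnth t i s))) -> 0 <= intb f.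
Proof.
elim: n f i => [f []//|n IH] f i bf.
case: (unliftP ord0 i) => [j ->|->] hf.
  rewrite intb_cons1//; apply: Rintegral_ge0 => s hs.
  apply: (IH _ j); first exact: bmeas_cons1.
  move=> t ht; have := hf _ (box_consP hs ht).
  by congr (_ <= int1 _); apply/funext => s'; rewrite set_tnthS.
rewrite intb_cons2//; apply: Rintegral_ge0 => t ht.
have := hf _ (box_consP side0 ht).
by congr (_ <= int1 _); apply/funext => s'; rewrite set_tnth0.
Qed.

(** Subadditivity of the variance (Efron-Stein): a one-dimensional Poincare
inequality along each axis gives the inequality on the box with the same
constant. Split off the first variable s; the induction hypothesis handles
the variance in the others at fixed s, and what remains is the variance of
the partial average Phi(s), which by Jensen is at most the average of the
variance in s. *)
Lemma variance_tensor n (F : n.-tuple mR -> R) (G : 'I_n -> n.-tuple mR -> R) :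
  bmeas F -> (forall i, bmeas (G i)) ->
  (forall i t, box n t ->
     int1 (fun s => F (set_tnth t i s) ^+ 2)
     - int1 (fun s => F (set_tnth t i s)) ^+ 2 / (2 * pi)
     <= int1 (fun s => G i (set_tnth t i s))) ->
  intb (fun t => F t ^+ 2) - intb F ^+ 2 / (2 * pi) ^+ n <= \sum_(i < n) intb (G i).
Proof.
have pi2 : 0 < 2 * pi :> R by rewrite mulr_gt0 ?pi_gt0.
have mass1 : fine (leb side) = 2 * pi by rewrite leb_side.
elim: n F G => [|n IH] F G bF bG hFG.
  rewrite big_ord0 expr0 divr1 subr_le0.
  have pt (h : 0.-tuple mR -> R) : intb h = h [tuple].
    rewrite /intb box0.
    have -> : h = fun=> h [tuple] by apply/funext => t; rewrite (tuple0 t).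
    by rewrite Rintegral_cst// -box0 (box_mass 0) mulr1.
  by rewrite !pt.
pose a : R := 2 * pi; pose b := a ^+ n; rewrite -/a in pi2 mass1 hFG *.
have b0 : 0 < b by exact: exprn_gt0.
have bF2 : bmeas (fun t => F t ^+ 2) by exact: bmeas_sqr.
pose Phi s := intb (fun t => F (Defs.cons_tuple (s, t))).
pose psi t := int1 (fun s => F (Defs.cons_tuple (s, t))).
have bPhi : bmeas Phi by exact: bmeas_intb.
have bpsi : bmeas psi by exact: bmeas_int1.
pose c := intb F.
have Phi_c : int1 Phi = c by rewrite /c intb_cons1.
have psi_c : intb psi = c by rewrite /c intb_cons2.
have ms := measurable_side; have ls := leb_side_lty.
have mb := measurable_box n; have lb := box_lty n.
(* The induction hypothesis at fixed s, integrated over s. *)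
have h1 : intb (fun t => F t ^+ 2) - int1 (fun s => Phi s ^+ 2) / b
    <= \sum_(i < n) intb (G (lift ord0 i)).
  rewrite intb_cons1// (eq_bigr _ (fun i _ => intb_cons1 (bG _))).
  rewrite [X in _ - X]mulrC -RintZ//; last exact: bmeas_sqr.
  rewrite -RintB//; [|exact: (bmeas_intb bF2)|by apply: bmeasZ; exact: bmeas_sqr].
  rewrite -Rint_sum//; last by move=> i; exact: (bmeas_intb (bG _)).
  apply: le_Rint => //.
  - apply: bmeasB; first exact: (bmeas_intb bF2).
    by apply: bmeasZ; exact: bmeas_sqr.
  - by apply: bmeas_sum => i; exact: (bmeas_intb (bG _)).
  move=> s hs; rewrite mulrC.
  apply: (IH (fun t => F (Defs.cons_tuple (s, t)))
    (fun i t => G (lift ord0 i) (Defs.cons_tuple (s, t)))).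
  - exact: bmeas_cons1.
  - by move=> i; exact: bmeas_cons1.
  move=> i t ht; have := hFG (lift ord0 i) _ (box_consP hs ht).
  by have -> := funext (set_tnthS s t i).
(* The hypothesis on the first axis, integrated over the other variables. *)
have h2 : intb (fun t => F t ^+ 2) - intb (fun t => psi t ^+ 2) / a
    <= intb (G ord0).
  rewrite intb_cons2// (intb_cons2 (bG _)).
  rewrite [X in _ - X]mulrC -RintZ//; last exact: bmeas_sqr.
  rewrite -RintB//; [|exact: (bmeas_int1 bF2)|by apply: bmeasZ; exact: bmeas_sqr].
  apply: le_Rint => //.
  - apply: bmeasB; first exact: (bmeas_int1 bF2).
    by apply: bmeasZ; exact: bmeas_sqr.
  - exact: (bmeas_int1 (bG _)).
  move=> t ht; rewrite mulrC; have := hFG ord0 _ (box_consP side0 ht).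
  by have -> := funext (set_tnth0 0 t).
(* Jensen: Phi - c / a is the integral over t of F - psi / a. *)
have h3 : int1 (fun s => Phi s ^+ 2) - c ^+ 2 / a
    <= b * (intb (fun t => F t ^+ 2) - intb (fun t => psi t ^+ 2) / a).
  pose K z := F (Defs.cons_tuple z) - psi z.2 / a.
  have bK : bmeas K.
    apply: bmeasB; first exact: bmeas_comp bF (@measurable_cons_tuple R n).
    under eq_fun do rewrite mulrC.
    apply: bmeasZ; exact: (bmeas_comp bpsi measurable_snd).
  have bK2 : bmeas (fun z => K z ^+ 2) by exact: bmeas_sqr.
  have -> : int1 (fun s => Phi s ^+ 2) - c ^+ 2 / a = int1 (fun s => (Phi s - c /
    a) ^+ 2).
    have e : \int[leb]_(s in side) Phi s = c by [].
    rewrite [RHS]Rint_sqrB// mass1 e -/(int1 _).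
    by field; rewrite gt_eqF.
  have -> : intb (fun t => F t ^+ 2) - intb (fun t => psi t ^+ 2) / a =
      int1 (fun s => intb (fun t => K (s, t) ^+ 2)).
    rewrite -[RHS](Rint_product1 ms mb ls lb bK2) (Rint_product2 ms mb ls lb bK2).
    rewrite intb_cons2// [X in _ - X]mulrC -RintZ//; last exact: bmeas_sqr.
    rewrite -RintB//; [|exact: (bmeas_int1 bF2)|by apply: bmeasZ; exact: bmeas_sqr].
    apply: eq_Rintegral => t _.
    rewrite /K /= Rint_sqrB//; last exact: bmeas_cons2.
    have e : \int[leb]_(s in side) F (Defs.cons_tuple (s, t)) = psi t by [].
    rewrite mass1 e -/(int1 _).
    by field; rewrite gt_eqF.
  rewrite -RintZ//; last exact: (bmeas_Rint1 mb lb bK2).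
  apply: le_Rint => //.
  - by apply: bmeas_sqr; apply: bmeasB => //; exact: bmeas_cst.
  - by apply: bmeasZ; exact: (bmeas_Rint1 mb lb bK2).
  move=> s _.
  have -> : Phi s - c / a = intb (fun t => K (s, t)).
    rewrite /intb RintB//; [|exact: bmeas_cons1|].
      have e : \int[lebesgue_tuple R n]_(t in box n) psi t = c by [].
      by under [X in _ = _ - X]eq_Rintegral do rewrite mulrC;
        rewrite RintZ// e mulrC.
    by under eq_fun do rewrite mulrC; exact: bmeasZ.
  by have := Rint_sqr_le mb lb (bmeas_pair1 bK s); rewrite box_mass; exact.
rewrite big_ord_recl -/c (_ : (2 * pi) ^+ n.+1 = a * b); last by rewrite exprS.
move: h3; rewrite -(ler_pM2l b0) in h2.
set u := intb _ in h1 h2 *; set v := intb _ in h2 *; set w := int1 _ in h1 *.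
move=> h3; have {h2}h3 : w - c ^+ 2 / a <= b * intb (G ord0) by exact: le_trans
  h3 h2.
have {}h3 : w / b - c ^+ 2 / a / b <= intb (G ord0).
  by rewrite -mulrBl ler_pdivrMr// [leRHS]mulrC.
have -> : c ^+ 2 / (a * b) = c ^+ 2 / a / b by field; rewrite !gt_eqF.
lra.
Qed.

End TupleIntegral.
Arguments box {R} n.

(** * The Wirtinger inequality *)

Section Wirtinger.
Context {R : realType}.
Local Notation mR := (measurableTypeR R).
Implicit Types (p q m c l : R) (h g : R -> R).

Definition intc p q (f : R -> R) : R := \int[@leb R]_(s in `[p, q]) f s.

Lemma int1_intc (f : mR -> R) : bmeas f -> int1 f = intc (- pi) pi f.
Proof.
move=> bf; have ibf : (@leb R).-integrable `[- pi, pi]%classic (EFin \o f).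
  apply: (bmeas_integrable _ _ bf) => //.
  by rewrite /leb /= lebesgue_measure_itv/=; case: ifPn => // _; rewrite ltry.
rewrite /int1 side_itv /intc Rintegral_itv_obnd_cbnd; last first.
  apply: integrableS ibf => //.
  by apply: subset_itv; rewrite bnd_simp.
by rewrite Rintegral_itv_bndo_bndc//; apply: integrableS ibf => //;
  apply: subset_itv; rewrite bnd_simp.
Qed.

Lemma intc_cat p q r (f : mR -> R) : bmeas f -> p <= q -> q <= r ->
  intc p q f + intc q r f = intc p r f.
Proof.
move=> bf pq qr; have ibf : (@leb R).-integrable `[p, r]%classic (EFin \o f).
  apply: (bmeas_integrable _ _ bf) => //.
  by rewrite /leb /= lebesgue_measure_itv/=; case: ifPn => // _; rewrite ltry.
have := @Rintegral_itvB _ f (BLeft p) (BRight r) q ibf; rewrite !bnd_simp.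
move=> /(_ pq qr); rewrite Rintegral_itv_obnd_cbnd; last first.
  by apply: integrableS ibf => //; apply: subset_itv; rewrite bnd_simp.
move=> e; apply: (@addrI _ (- intc p q f)); rewrite addKr addrC; exact: esym e.
Qed.

Lemma continuous_segment_integrable p q (f : R -> R) :
  {in `[p, q], continuous f} -> (@leb R).-integrable `[p, q]%classic (EFin \o f).
Proof.
move=> cf; apply: continuous_compact_integrable; first exact: segment_compact.
by apply: continuous_in_subspaceT => x /[1!inE]; exact: cf.
Qed.

Lemma intc_ftc p q h g : p < q ->
  {in `[p, q], continuous h} -> {in `[p, q], continuous g} ->
  (forall s, s \in `]p, q[ -> is_derive s 1 h (g s)) ->
  intc p q g = h q - h p.
Proof.
move=> pq ch cg dh; rewrite /intc /Rintegral (continuous_FTC2 (F := h)) => //.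
- by apply: continuous_in_subspaceT => x /[1!inE]; exact: cg.
- split.
  + by move=> s /dh -[].
  + by apply: cvg_at_right_filter; apply: ch; rewrite in_itv/= lexx ltW.
  + by apply: cvg_at_left_filter; apply: ch; rewrite in_itv/= lexx ltW.
- by move=> s /dh ds; rewrite derive1E derive_val.
Qed.


(** With k = h - c and theta = l (s - m), the derivative of l k^2 tan theta is
2 l k k' tan theta + l^2 k^2 (1 + tan^2 theta), so that
k'^2 - l^2 k^2 = (k' + l k tan theta)^2 - (l k^2 tan theta)'. Since l < 1,
tan theta has no pole on an interval of length at most pi centred at m, so the
primitive l k^2 tan theta is continuously differentiable up to the end points. *)
Lemma wirtinger_piece p q m c l h g :
  0 < l < 1 -> p <= q -> m - pi / 2 <= p -> q <= m + pi / 2 ->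
  continuous h -> continuous g ->
  (forall s, s \in `]p, q[ -> is_derive s 1 h (g s)) ->
  l ^+ 2 * intc p q (fun s => (h s - c) ^+ 2) <=
  intc p q (fun s => g s ^+ 2)
  + (l * (h q - c) ^+ 2 * tan (l * (q - m)) - l * (h p - c) ^+ 2 * tan (l * (p -
    m))).
Proof.
move=> /andP[l0 l1] pq mp qm ch cg dh.
have [<-|npq] := eqVneq p q.
  by rewrite /intc set_itv1 !Rintegral_set1 mulr0 subrr addr0.
have {npq}ltpq : p < q by rewrite lt_neqAle npq.
have cosn0 s : s \in `[p, q] -> cos (l * (s - m)) != 0.
  rewrite in_itv/= => /andP[ps sq]; rewrite gt_eqF// cos_gt0_pihalf//.
  have := pi_gt0 R; move=> pi0; apply/andP; split; nra.
pose T s := l * (h s - c) ^+ 2 * tan (l * (s - m)).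
pose e s := 2 * l * (h s - c) * g s * tan (l * (s - m))
  + l ^+ 2 * (h s - c) ^+ 2 * (cos (l * (s - m))) ^- 2.
have clin : continuous (fun s : R => l * (s - m)).
  by move=> s; apply: cvgM; [exact: cvg_cst|apply: cvgB;
    [exact: cvg_id|exact: cvg_cst]].
have ctan : {in `[p, q], continuous (fun s => tan (l * (s - m)))}.
  move=> s /cosn0 cs.
  by apply: (@continuous_comp _ _ _ (fun s : R => l * (s - m)) tan);
    [exact: clin|exact: continuous_tan].
have chc : continuous (fun s => h s - c).
  by move=> s; apply: cvgB; [exact: ch|exact: cvg_cst].
have cT : {in `[p, q], continuous T}.
  move=> s sI; apply: cvgM; last exact: ctan.
  by apply: cvgM; [exact: cvg_cst|];
    apply: (@continuous_comp _ _ _ (fun s => h s - c) (fun x => x ^+ 2));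
    [exact: chc|exact: exprn_continuous].
have ce : {in `[p, q], continuous e}.
  move=> s sI; apply: cvgD; apply: cvgM.
  - by do 2 (apply: cvgM; last by [exact: cg|exact: chc]); exact: cvg_cst.
  - exact: ctan.
  - by apply: cvgM; [exact: cvg_cst|];
    apply: (@continuous_comp _ _ _ (fun s => h s - c) (fun x => x ^+ 2));
    [exact: chc|exact: exprn_continuous].
  - apply: cvgV; first by rewrite expf_neq0// cosn0.
    apply: (@continuous_comp _ _ _ (fun s => cos (l * (s - m))) (fun x => x ^+
      2)); last exact: exprn_continuous.
    by apply: (@continuous_comp _ _ _ (fun s : R => l * (s - m)) cos);
      [exact: clin|exact: continuous_cos].
have dT s : s \in `]p, q[ -> is_derive s 1 T (e s).
  move=> sI; have cs : cos (l * (s - m)) != 0.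
    by apply: cosn0; apply: subset_itv_oo_cc sI.
  have dhs := dh _ sI.
  have dlin : is_derive s 1 (fun s : R => l * (s - m)) l.
    rewrite (_ : (fun _ => _) = l \*: (id - cst m)); last by [].
    by apply: is_derive_eq; rewrite subr0 /GRing.scale/= mulr1.
  have dtan : is_derive s 1 (fun s => tan (l * (s - m))) ((cos (l * (s - m))) ^-
    2 * l).
    exact: (@is_derive1_comp _ tan (fun s : R => l * (s - m)) _ _ _
      (is_derive_tan cs) dlin).
  rewrite (_ : T = (l \*: ((h - cst c) ^+ 2)) * (fun s => tan (l * (s - m))));
    last by [].
  apply: is_derive_eq.
  have sE (a b : R) : a *: b = a * b by [].
  by rewrite /e !fctE /= !sE; ring.
have key : intc p q e = T q - T p by exact: intc_ftc.
rewrite -/(T q) -/(T p) -key /intc.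
have cg2 : {in `[p, q], continuous (fun s => g s ^+ 2)}.
  move=> s _; apply: (@continuous_comp _ _ _ g (fun x => x ^+ 2));
    [exact: cg|exact: exprn_continuous].
have ch2 : {in `[p, q], continuous (fun s => (h s - c) ^+ 2)}.
  move=> s _; apply: (@continuous_comp _ _ _ (fun s => h s - c) (fun x => x ^+
    2)); [exact: chc|exact: exprn_continuous].
rewrite -RintegralZl//; last exact: continuous_segment_integrable.
rewrite -RintegralD//; [|exact: continuous_segment_integrable..].
apply: le_Rintegral => //.
- apply: (continuous_segment_integrable (f := fun s => l ^+ 2 * (h s - c) ^+ 2))
  => s sI.
  by apply: cvgM; [exact: cvg_cst|exact: ch2].
- apply: (continuous_segment_integrable (f := fun s => g s ^+ 2 + e s)) => s sI.
  by apply: cvgD; [exact: cg2|exact: ce].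
move=> s sI; have cs : cos (l * (s - m)) != 0 by apply: cosn0.
rewrite -subr_ge0 (_ : _ - _ = (g s + l * (h s - c) * tan (l * (s - m))) ^+ 2).
  exact: sqr_ge0.
by rewrite /e cos2_tan2//; ring.
Qed.

(** There is a with h a = h (a + pi), by the intermediate value theorem for
h (s + pi) - h s, which changes sign over half a period. With c = h a the
boundary terms of [wirtinger_piece] vanish at a and a + pi, and by
periodicity they cancel between - pi and pi. Letting l tend to 1 bounds
the integral of (h - c)^2, hence the variance of h. *)
Lemma wirtinger h g : continuous h -> continuous g ->
  bmeas (h : mR -> R) -> bmeas (g : mR -> R) ->
  (forall s, - pi < s < pi -> is_derive s 1 h (g s)) -> h (- pi) = h pi ->
  int1 (fun s => h s ^+ 2) - int1 h ^+ 2 / (2 * pi) <= int1 (fun s => g s ^+ 2).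
Proof.
move=> ch cg bh bg dh per; have pi0 := pi_gt0 R.
have [a aI ha] : exists2 a, a \in `[- pi, 0] & h (a + pi) - h a = 0.
  pose phi s := h (s + pi) - h s.
  apply: (@IVT R phi (- pi) 0 0); first by rewrite oppr_le0 ltW.
    apply: continuous_subspaceT => s; apply: cvgB; last exact: ch.
    apply: (@continuous_comp _ _ _ (fun s : R => s + pi) h); last exact: ch.
    by apply: cvgD; [exact: cvg_id|exact: cvg_cst].
  by rewrite /phi addNr add0r per ge_min le_max; lra.
have {}ha : h (a + pi) = h a by apply/eqP; rewrite -subr_eq0 ha.
move: aI; rewrite in_itv/= => /andP[a1 a2].
pose c := h a.
have bk : bmeas (fun s : mR => (h s - c) ^+ 2).
  by apply: bmeas_sqr; apply: bmeasB => //; exact: bmeas_cst.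
have bg2 : bmeas (fun s : mR => g s ^+ 2) by exact: bmeas_sqr.
have scaled l : 0 < l < 1 ->
    l ^+ 2 * int1 (fun s => (h s - c) ^+ 2) <= int1 (fun s => g s ^+ 2).
  move=> l01.
  have dsub p q s : - pi <= p -> q <= pi -> s \in `]p, q[ -> is_derive s 1 h (g s).
    by rewrite in_itv/= => ? ? /andP[? ?]; apply: dh; apply/andP; split; lra.
  have a3 : a <= a + pi by lra.
  have a4 : a + pi <= pi by lra.
  have a5 : a <= pi by lra.
  have npi : (- pi : R) <= a + pi by lra.
  (* The three centres are chosen such that the arcs [a, a + pi] and
     [a + pi, a + 2 pi], the latter cut at pi and glued to - pi, both have their
     ends at distance pi / 2 from the centre. *)
  have w p q m : - pi <= p -> p <= q -> q <= pi -> m - pi / 2 <= p -> q <= m + pi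
    / 2 ->
      l ^+ 2 * intc p q (fun s => (h s - c) ^+ 2) <= intc p q (fun s => g s ^+ 2)
      + (l * (h q - c) ^+ 2 * tan (l * (q - m)) - l * (h p - c) ^+ 2 * tan (l *
        (p - m))).
    move=> hp pq hq hm1 hm2; apply: wirtinger_piece => // s; exact: dsub.
  have w1 := w (- pi) a (a - pi / 2) (lexx _) a1 a5.
  have {}w1 := w1 ltac:(lra) ltac:(lra).
  have w2 := w a (a + pi) (a + pi / 2) a1 a3 a4.
  have {}w2 := w2 ltac:(lra) ltac:(lra).
  have w3 := w (a + pi) pi (a + 3 * (pi / 2)) npi a4 (lexx _).
  have {w}w3 := w3 ltac:(lra) ltac:(lra).
  rewrite !int1_intc// -(intc_cat bk a1 a5) -(intc_cat bk a3 a4).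
  rewrite -(intc_cat bg2 a1 a5) -(intc_cat bg2 a3 a4).
  move: w1 w2 w3; rewrite ha /c subrr expr0n/= !mulr0 !mul0r -per.
  rewrite (_ : - pi - (a - pi / 2) = - pi / 2 - a); last by field.
  rewrite (_ : pi - (a + 3 * (pi / 2)) = - pi / 2 - a); last by field.
  by lra.
have kg : int1 (fun s => (h s - c) ^+ 2) <= int1 (fun s => g s ^+ 2).
  rewrite leNgt; apply/negP => gk.
  have g0 : 0 <= int1 (fun s => g s ^+ 2) by apply: Rintegral_ge0 => s _;
    exact: sqr_ge0.
  move: gk g0 scaled; set G := int1 _; set K := int1 _ => gk g0 scaled.
  have K0 : 0 < K := le_lt_trans g0 gk.
  have r1 : G / K < 1 by rewrite ltr_pdivrMr// mul1r.
  have r0 : 0 <= G / K by rewrite divr_ge0// ltW.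
  have GE : G = (G / K) * K by rewrite mulfVK// gt_eqF.
  move: (G / K) GE r1 r0 => r GE r1 r0.
  have l01 : 0 < (1 + r) / 2 < 1 by apply/andP; split; lra.
  have {l01} := scaled _ l01.
  rewrite GE ler_pM2r//; clear -r1 r0; nra.
apply: le_trans kg.
have -> : int1 (fun s => (h s - c) ^+ 2) =
    int1 (fun s => h s ^+ 2) - 2 * c * int1 h + c ^+ 2 * (2 * pi).
  rewrite -[2 * pi]/(fine (2 * pi)%:E) -leb_side.
  exact: (Rint_sqrB measurable_side leb_side_lty c bh).
rewrite -subr_ge0 (_ : _ - _ = (c * (2 * pi) - int1 h) ^+ 2 / (2 * pi)).
  by rewrite divr_ge0 ?sqr_ge0// mulr_ge0// ltW.
by field; lra.
Qed.

End Wirtinger.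

(** * Integration by parts and the Poincare inequality on the cube *)

Section CubeCalculus.
Context {R : realType} {d : nat}.
Local Notation mR := (measurableTypeR R).
Local Notation rV := 'rV[R]_d.
Implicit Types (f g u : rV -> R) (x y : rV) (i j : 'I_d).

(** The measure lives on tuples with the product sigma-algebra while continuity
is that of row vectors; an open set is a countable union of boxes with
rational centres and radii 1 / (n + 1). *)
Lemma measurable_tuple_row_open (O : set rV) : open O ->
  measurable (@tuple_row R d @^-1` O).
Proof.
move=> oO.
pose B (z : 'rV[rat]_d * nat) : set rV :=
  [set x | forall i, `|ratr (z.1 0 i) - x 0 i| < z.2.+1%:R^-1].
pose F z : set (d.-tuple mR) :=
  if pselect (B z `<=` O) then @tuple_row R d @^-1` B z else set0.
rewrite [X in measurable X](_ : _ = \bigcup_z F z); last first.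
  apply/seteqP; split=> t /=; last first.
    by move=> [z _]; rewrite /F; case: pselect => [sub Bz|_ []]; exact (sub _ Bz).
  move=> Ot; have /nbhs_ballP[e /= e0 eO] := open_nbhs_nbhs (conj oO Ot).
  have [n nP] : exists n : nat, n.+1%:R^-1 < e / 2.
    have [n _ nP] := near_infty_natSinv_lt (PosNum (divr_gt0 e0 (@ltr0Sn R 1))).
    by exists n; exact: (nP n (leqnn n)).
  have n0 : 0 < n.+1%:R^-1 :> R by [].
  have qP i : exists q : rat, `|ratr q - tnth t i| < n.+1%:R^-1.
    have /rat_in_itvoo[q] : tnth t i - n.+1%:R^-1 < tnth t i + n.+1%:R^-1.
      by rewrite ltrD2l gtrN.
    by rewrite in_itv/= => qI; exists q; rewrite distrC ltr_distlC.
  have [q qE] := choice qP.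
  exists (\row_i q i, n) => //; rewrite /F; case: pselect => [_ i|BO].
    by rewrite /= !mxE.
  exfalso; apply: BO => x Bx; apply: eO; split => // i0 i; rewrite ord1 !mxE.
  rewrite /ball/=; have := Bx i; have := qE i; rewrite /= !mxE.
  set a := ratr _ => h1 h2.
  rewrite (_ : _ - _ = - (a - tnth t i) + (a - x 0 i)); last by ring.
  rewrite (le_lt_trans (ler_normD _ _))// normrN.
  by rewrite [ltRHS]splitr ltrD//; apply: lt_trans nP.
have cz : countable [set: 'rV[rat]_d * nat] by exact: countableP.
apply: (countable_bigcupT_measurable cz) => z.
rewrite /F; case: pselect => [sub|nsub] /=; last exact: measurable0.
rewrite (_ : _ @^-1` _ = \bigcap_(i in [set: 'I_d])
   ((fun t => tnth t i) @^-1` [set s : mR | `|ratr (z.1 0 i) - s| <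
     z.2.+1%:R^-1])); last first.
  apply/seteqP; split=> t /= h i; first by move=> _; have := h i; rewrite mxE.
  by rewrite mxE; exact: h.
apply: fin_bigcap_measurable => // i _; rewrite -[X in measurable X]setTI.
apply: measurable_tnth => //.
rewrite (_ : [set _ | _] = ball (ratr (z.1 0 i) : R) (z.2.+1%:R^-1)); last by [].
exact: measurable_ball.
Qed.

Lemma measurable_tuple_row_fun f : continuous f ->
  measurable_fun setT (f \o @tuple_row R d).
Proof.
move=> /continuousP cf; apply: (measurability _ (RGenOpens.measurableE R)) => //.
move=> _ [_ [a [b ->]] <-]; rewrite setTI comp_preimage.
by apply: measurable_tuple_row_open; apply: cf; exact: interval_open.
Qed.

(** Functions are continuous on the whole space: derivatives of psi are extended
from the closed cube by clamping, so that no subspace topology occurs in the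
computations. *)
Definition bcont f : Prop := continuous f /\ exists M, forall x, `|f x| <= M.

Lemma bcont_bmeas f : bcont f -> bmeas (f \o @tuple_row R d).
Proof.
move=> [cf [M fM]]; split; first exact: measurable_tuple_row_fun.
by exists M => x; exact: fM.
Qed.

Lemma bcont_cst (c : R) : bcont (fun _ : rV => c).
Proof. by split; [exact: cst_continuous|exists `|c|]. Qed.

Lemma bcontD f g : bcont f -> bcont g -> bcont (fun x => f x + g x).
Proof.
move=> [cf [M fM]] [cg [N gN]]; split; first by move=> x;
  exact: (cvgD (cf x) (cg x)).
by exists (M + N) => x; rewrite (le_trans (ler_normD _ _))// lerD.
Qed.

Lemma bcontM f g : bcont f -> bcont g -> bcont (fun x => f x * g x).
Proof.
move=> [cf [M fM]] [cg [N gN]]; split; first by move=> x;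
  exact: (cvgM (cf x) (cg x)).
by exists (M * N) => x; rewrite normrM ler_pM.
Qed.

Lemma bcontZ (c : R) f : bcont f -> bcont (fun x => c * f x).
Proof. by move=> cf; apply: bcontM => //; exact: bcont_cst. Qed.

Lemma bcontN f : bcont f -> bcont (fun x => - f x).
Proof. by move=> cf; under eq_fun do rewrite -mulN1r; exact: bcontZ. Qed.

Lemma bcontB f g : bcont f -> bcont g -> bcont (fun x => f x - g x).
Proof. by move=> cf cg; apply: bcontD => //; exact: bcontN. Qed.

Lemma bcontX f n : bcont f -> bcont (fun x => f x ^+ n).
Proof.
move=> cf; elim: n => [|n IH]; first by under eq_fun do rewrite expr0;
  exact: bcont_cst.
by under eq_fun do rewrite exprS; exact: bcontM.
Qed.

Lemma bcont_sum (T : Type) (r : seq T) (F : T -> rV -> R) :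
  (forall k, bcont (F k)) -> bcont (fun x => \sum_(k <- r) F k x).
Proof.
move=> bF; elim: r => [|k r IH].
  by under eq_fun do rewrite big_nil; exact: bcont_cst.
by under eq_fun do rewrite big_cons; exact: bcontD.
Qed.

Lemma bcont_sin i : bcont (fun x => sin (x 0 i)).
Proof.
split; last by exists 1 => x; rewrite ler_norml sin_geN1 sin_le1.
move=> x; apply: (@continuous_comp _ _ _ (fun x : rV => x 0 i) sin);
  last exact: continuous_sin.
exact: coord_continuous.
Qed.

Lemma bcont_cos i : bcont (fun x => cos (x 0 i)).
Proof.
split; last by exists 1 => x; rewrite ler_norml cos_geN1 cos_le1.
move=> x; apply: (@continuous_comp _ _ _ (fun x : rV => x 0 i) cos);
  last exact: continuous_cos.
exact: coord_continuous.
Qed.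

Definition cint (f : rV -> R) : R := intb (f \o @tuple_row R d).

Lemma tuple_row_cube : @tuple_row R d @^-1` cube = box d.
Proof. by apply/seteqP; split => t h i; have := h i; rewrite mxE. Qed.

Lemma cube_integralE f : bcont f ->
  cube_integral (fun x => (f x)%:E) = (cint f)%:E.
Proof.
move=> cf; rewrite /cube_integral tuple_row_cube /cint /intb /Rintegral fineK//.
apply: integrable_fin_num; first exact: measurable_box.
by apply: (bmeas_integrable _ _ (bcont_bmeas cf));
  [exact: measurable_box|exact: box_lty].
Qed.

Lemma cintD f g : bcont f -> bcont g -> cint (fun x => f x + g x) = cint f + cint g.
Proof.
move=> cf cg; rewrite /cint /intb -RintD//; first exact: measurable_box.
- exact: box_lty.
- exact: bcont_bmeas.
- exact: bcont_bmeas.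
Qed.

Lemma cintZ (c : R) f : bcont f -> cint (fun x => c * f x) = c * cint f.
Proof.
move=> cf; rewrite /cint /intb -RintZ//; first exact: measurable_box.
- exact: box_lty.
- exact: bcont_bmeas.
Qed.

Lemma cintB f g : bcont f -> bcont g -> cint (fun x => f x - g x) = cint f - cint g.
Proof.
move=> cf cg; rewrite cintD//; last exact: bcontN.
by congr (_ + _); rewrite -mulN1r -cintZ//; congr cint; apply/funext => x;
  rewrite mulN1r.
Qed.

Lemma cint_sum (T : Type) (r : seq T) (F : T -> rV -> R) :
  (forall k, bcont (F k)) -> cint (fun x => \sum_(k <- r) F k x) = \sum_(k <- r)
    cint (F k).
Proof.
move=> bF; rewrite /cint /intb -Rint_sum//; first exact: measurable_box.
- exact: box_lty.
- by move=> k; exact: bcont_bmeas.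
Qed.

Lemma le_cint f g : bcont f -> bcont g -> (forall x, cube x -> f x <= g x) ->
  cint f <= cint g.
Proof.
move=> cf cg fg; apply: le_Rint; first exact: measurable_box.
- exact: box_lty.
- exact: bcont_bmeas.
- exact: bcont_bmeas.
by move=> t; rewrite -tuple_row_cube; exact: fg.
Qed.

Lemma cint_ge0 f : (forall x, cube x -> 0 <= f x) -> 0 <= cint f.
Proof.
move=> f0; apply: Rintegral_ge0 => t; rewrite -tuple_row_cube; exact: f0.
Qed.

Lemma eq_cint f g : (forall x, cube x -> f x = g x) -> cint f = cint g.
Proof.
move=> fg; apply: eq_Rintegral => t; rewrite inE -tuple_row_cube; exact: fg.
Qed.

Lemma set_coord_continuous x i : continuous (fun s : R => set_coord x i s).
Proof.
move=> s; apply/cvg_ballP => e e0; near=> s'; split=> // i0 j; rewrite !mxE.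
case: eqP => _; last exact: ballxx.
by near: s'; exists e.
Unshelve. all: by end_near. Qed.

Lemma cube_set_coord x i (s : R) : cube x -> - pi < s < pi -> cube (set_coord x i
  s).
Proof. by move=> cx hs j; rewrite mxE; case: eqP => // _; exact: cx. Qed.

Lemma tuple_row_set_tnth (t : d.-tuple mR) i (s : mR) :
  tuple_row (set_tnth t i s) = set_coord (tuple_row t) i s.
Proof. by apply/rowP => j; rewrite !mxE tnth_mktuple. Qed.

Definition has_partial i f g : Prop :=
  forall x, cube x -> is_derive x (delta_mx 0 i) f (g x).

Lemma is_derive_slice x i f (s l : R) :
  is_derive (set_coord x i s) (delta_mx 0 i) f l ->
  is_derive s 1 (fun s' => f (set_coord x i s')) l.
Proof.
have E : (fun h : R => h^-1 *: ((f \o shift (set_coord x i s)) (h *: delta_mx 0 i) -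
    f (set_coord x i s))) =
  (fun h : R => h^-1 *: (((fun s' => f (set_coord x i s')) \o shift s) (h *: 1) -
    (fun s' => f (set_coord x i s')) s)).
  apply/funext => h /=; congr (_ *: (f _ - _)); apply/rowP => j; rewrite !mxE.
  by rewrite eqxx/=; case: eqP => _ /=; rewrite ?mulr0 ?add0r.
by case=> [df vf]; split; rewrite /derivable /derive -E.
Qed.

Lemma slice_bmeas x i f : bcont f -> bmeas (fun s : mR => f (set_coord x i s)).
Proof.
move=> [cf [M fM]]; split; last by exists M => s; exact: fM.
apply: continuous_measurable_fun => s.
apply: (@continuous_comp _ _ _ (fun s : R => set_coord x i s) f); last exact: cf.
exact: set_coord_continuous.
Qed.

Lemma slice_continuous x i f : bcont f -> continuous (fun s : R => f (set_coord x
  i s)).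
Proof.
move=> [cf _] s.
apply: (@continuous_comp _ _ _ (fun s : R => set_coord x i s) f); last exact: cf.
exact: set_coord_continuous.
Qed.

Lemma has_partial_slice i f g x (s : R) : has_partial i f g -> cube x ->
  - pi < s < pi ->
  is_derive s 1 (fun s' => f (set_coord x i s')) (g (set_coord x i s)).
Proof. by move=> fg cx hs; apply: is_derive_slice; apply: fg;
  exact: cube_set_coord. Qed.

Lemma cube_closed x : cube x -> closed_cube x.
Proof. by move=> cx i; have /andP[a b] := cx i; rewrite !ltW. Qed.

(** Integration by parts. On each line parallel to the i-th axis the fundamental
theorem of calculus leaves the difference of two boundary values, which agree
by periodicity. *)
Lemma cint_partial i f g : bcont f -> bcont g -> periodic_closed_cube f ->
  has_partial i f g -> cint g = 0.
Proof.
move=> cf cg pf fg; have pi0 := pi_gt0 R.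
have slice0 (t : d.-tuple mR) : box d t ->
    int1 (fun s => g (tuple_row (set_tnth t i s))) = 0.
  move=> bt; have ct : cube (tuple_row t) by rewrite -tuple_row_cube in bt.
  under eq_fun do rewrite tuple_row_set_tnth.
  rewrite int1_intc; last exact: slice_bmeas.
  have dfs s : s \in `]- pi, pi[ -> is_derive s 1
      (fun s' => f (set_coord (tuple_row t) i s')) (g (set_coord (tuple_row t) i
        s)).
    by rewrite in_itv/= => hs; exact: has_partial_slice.
  have -> := @intc_ftc R (- pi) pi (fun s => f (set_coord (tuple_row t) i s))
    (fun s => g (set_coord (tuple_row t) i s)) ltac:(lra)
    (fun s _ => @slice_continuous _ i f cf s)
    (fun s _ => @slice_continuous _ i g cg s) dfs.
  by rewrite pf ?subrr//; exact: cube_closed.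
apply/eqP; rewrite eq_le; apply/andP; split; last first.
  by apply: (intb_ge0_slice (i := i)) => [|t bt];
    [exact: bcont_bmeas|rewrite slice0].
rewrite -oppr_ge0 -mulN1r -cintZ//.
apply: (intb_ge0_slice (i := i)) => [|t bt]; first by apply: bcont_bmeas;
  exact: bcontZ.
rewrite /int1 /= RintZ ?[X in _ * X]slice0 ?mulr0//.
- exact: measurable_side.
- exact: leb_side_lty.
under eq_fun do rewrite tuple_row_set_tnth; exact: slice_bmeas.
Qed.

(** Wirtinger on the lines, tensorised; the constant 1 is the one that H and HR
need at the bottom of their recursions. *)
Lemma cint_poincare f (g : 'I_d -> rV -> R) : bcont f -> (forall i, bcont (g i)) ->
  periodic_closed_cube f -> (forall i, has_partial i f (g i)) -> cint f = 0 ->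
  cint (fun x => f x ^+ 2) <= \sum_(i < d) cint (fun x => g i x ^+ 2).
Proof.
move=> cf cg pf fg f0.
have := @variance_tensor R d (f \o @tuple_row R d) (fun i t => g i (tuple_row t)
  ^+ 2).
rewrite -/(cint f) f0 expr0n/= mul0r subr0; apply.
- exact: bcont_bmeas.
- by move=> i; apply: (@bcont_bmeas (fun x => g i x ^+ 2)); exact: bcontX.
move=> i t bt; have ct : cube (tuple_row t) by rewrite -tuple_row_cube in bt.
under eq_fun do rewrite tuple_row_set_tnth.
under [X in _ - int1 X ^+ 2 / _]eq_fun do rewrite /= tuple_row_set_tnth.
under [X in _ <= int1 X]eq_fun do rewrite tuple_row_set_tnth.
apply: (@wirtinger R (fun s => f (set_coord (tuple_row t) i s))
  (fun s => g i (set_coord (tuple_row t) i s))).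
- exact: slice_continuous.
- exact: slice_continuous.
- exact: slice_bmeas.
- exact: slice_bmeas.
- by move=> s hs; exact: has_partial_slice.
- by rewrite pf//; exact: cube_closed.
Qed.

End CubeCalculus.

(** * The regularised weight *)

Section WeightInequalities.
Context {R : realFieldType}.

(** The zeroth-order coefficient in the Hardy inequality, with e = 2p and T the
sum of the sin^4(x_j / 2). For del = 0 and T = om^2 / d it vanishes
identically; the regularisation only adds nonnegative terms, so the constants
do not depend on del. The expression is affine in e, which suggests the
decomposition into its values at e = 0 and e = d. *)
Lemma hardy_scalar (d e del om T : R) (w := (1 - del) * om + del * d) :
  0 < d -> 0 <= e <= d -> 0 <= del <= 1 -> 0 <= om <= d -> om ^+ 2 <= d * T ->
  0 <= w * (d - 2 * om) - ((d - e) / 2 + (1 - del) * e) * (om - T)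
       + (3 * d - e) / (2 * d) * w ^+ 2 - (d - e) / 2 * w.
Proof.
move=> d0 /andP[e0 ed] /andP[l0 l1] /andP[om0 omd] hT.
pose t := om / d; pose r := T - om ^+ 2 / d; pose m := del * (1 - t).
have t0 : 0 <= t by rewrite divr_ge0// ltW.
have t1 : t <= 1 by rewrite ler_pdivrMr // mul1r.
have m0 : 0 <= m by apply: mulr_ge0; lra.
have r0 : 0 <= r by rewrite subr_ge0 ler_pdivrMr// mulrC.
rewrite (_ : _ - _ = d * (d - e) * (m / 2 + t * m + 3 * m ^+ 2 / 2)
  + d * e * (m + m ^+ 2 + del * (t * (1 - t)))
  + ((d - e) / 2 + (1 - del) * e) * r); last first.
  by rewrite /w /r /m /t; field; rewrite gt_eqF.
have m2 : 0 <= m ^+ 2 by exact: sqr_ge0.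
have tt : 0 <= t * (1 - t) by apply: mulr_ge0; lra.
have tm : 0 <= t * m by exact: mulr_ge0.
have dt : 0 <= del * (t * (1 - t)) by exact: mulr_ge0.
apply: addr_ge0; [apply: addr_ge0|apply: mulr_ge0 => //].
- by apply: mulr_ge0; [apply: mulr_ge0|]; lra.
- by apply: mulr_ge0; [apply: mulr_ge0|]; lra.
- by apply: addr_ge0; [|apply: mulr_ge0]; lra.
Qed.

(** The analogue of [hardy_scalar] for the second-order field, with g = 2(q + 1);
again del contributes with a favourable sign. *)
Lemma rellich_scalar (d g del om T : R) (w := (1 - del) * om + del * d) :
  0 < d -> 0 <= g <= d -> 0 <= del <= 1 -> 0 <= om <= d -> om ^+ 2 <= d * T ->
  (d - g) * w - (2 - g / d) * w ^+ 2 <=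
  (1 - del) * (w * (d - 2 * om) - g * (1 - del) * (om - T)).
Proof.
move=> d0 /andP[e0 ed] /andP[l0 l1] /andP[om0 omd] hT.
pose t := om / d; pose r := T - om ^+ 2 / d.
have t0 : 0 <= t by rewrite divr_ge0// ltW.
have t1 : t <= 1 by rewrite ler_pdivrMr // mul1r.
have r0 : 0 <= r by rewrite subr_ge0 ler_pdivrMr// mulrC.
rewrite -subr_ge0 (_ : _ - _ = d * (d - g) * (((1 - del) * t + del) * del)
  + d * g * del + (1 - del) ^+ 2 * (g * r)); last first.
  by rewrite /w /r /t; field; rewrite gt_eqF.
have s0 : 0 <= (1 - del) * t by apply: mulr_ge0; lra.
apply: addr_ge0; [apply: addr_ge0|by apply: mulr_ge0;
  [exact: sqr_ge0|exact: mulr_ge0]].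
- by apply: mulr_ge0; apply: mulr_ge0; lra.
- by apply: mulr_ge0 => //; apply: mulr_ge0; lra.
Qed.

Lemma sum_sqr_le (n : nat) (y : 'I_n -> R) :
  (\sum_i y i) ^+ 2 <= n%:R * \sum_i y i ^+ 2.
Proof.
case: n y => [|n] y; first by rewrite !big_ord0 expr0n mulr0.
have n0 : 0 < n.+1%:R :> R by [].
set S := \sum_i y i; pose c := S / n.+1%:R.
have : 0 <= \sum_i (y i - c) ^+ 2 by apply: sumr_ge0 => i _; exact: sqr_ge0.
rewrite (eq_bigr (fun i => y i ^+ 2 + - 2 * c * y i + c ^+ 2));
  last by move=> i _; ring.
rewrite !big_split/= -mulr_sumr -/S sumr_const card_ord -[c ^+ 2 *+ _]mulr_natl.
set q := \sum_i y i ^+ 2 => h.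
rewrite -subr_ge0 (_ : _ - _ = n.+1%:R * (q + - 2 * c * S + n.+1%:R * c ^+ 2)).
  by rewrite mulr_ge0// ltW.
by rewrite /c; field; rewrite gt_eqF.
Qed.

End WeightInequalities.

Section Weights.
Context {R : realType} {d : nat}.
Local Notation rV := 'rV[R]_d.
Implicit Types (f g u : rV -> R) (x y : rV) (i j : 'I_d).

(** Being stable under products, this predicate produces the integrands of the
integrations by parts together with the proof that they integrate to 0. *)
Definition pderiv i f g : Prop :=
  [/\ bcont f, bcont g, periodic_closed_cube f & has_partial i f g].

Lemma cint_pderiv i f g : pderiv i f g -> cint g = 0.
Proof. by case=> cf cg pf hp; exact: cint_partial hp. Qed.

Lemma pderiv_eq i f g h : pderiv i f g -> g = h -> pderiv i f h.
Proof. by move=> + <-. Qed.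

Lemma pderivM i f f' g g' : pderiv i f f' -> pderiv i g g' ->
  pderiv i (fun x => f x * g x) (fun x => f' x * g x + f x * g' x).
Proof.
move=> [cf cf' pf df] [cg cg' pg dg]; split.
- exact: bcontM.
- by apply: bcontD; exact: bcontM.
- by move=> j x cx; rewrite pf// pg.
- move=> x cx; have dfx := df x cx; have dgx := dg x cx.
  apply: (is_derive_eq (is_deriveM dfx dgx)).
  by rewrite addrC /GRing.scale/= mulrC.
Qed.

Lemma pderivX i f f' n : pderiv i f f' ->
  pderiv i (fun x => f x ^+ n) (fun x => n%:R * f x ^+ n.-1 * f' x).
Proof.
move=> [cf cf' pf df]; split.
- exact: bcontX.
- by apply: bcontM => //; apply: bcontZ; exact: bcontX.
- by move=> j x cx; rewrite pf.
- move=> x cx; have dfx := df x cx.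
  rewrite (_ : (fun x => _) = f ^+ n); last by apply/funext => y; rewrite exprfctE.
  exact: (is_deriveX n dfx).
Qed.

Lemma is_derive_line x (v : rV) f (l : R) :
  is_derive (0 : R) 1 (fun h : R => f (h *: v + x)) l -> is_derive x v f l.
Proof.
have E : (fun h : R => h^-1 *: ((f \o shift x) (h *: v) - f x)) =
  (fun h : R => h^-1 *: (((fun h : R => f (h *: v + x)) \o shift 0) (h *: 1) -
    (fun h : R => f (h *: v + x)) 0)).
  by apply/funext => h /=; rewrite addr0 scale0r add0r [h *: 1]mulr1.
by case=> [df vf]; split; rewrite /derivable /derive E.
Qed.

Lemma is_derive_coord i j x (phi : R -> R) (l : R) : is_derive (x 0 j) 1 phi l ->
  is_derive x (delta_mx 0 i) (fun y => phi (y 0 j)) ((j == i)%:R * l).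
Proof.
move=> dphi; apply: is_derive_line.
rewrite (_ : (fun h : R => _) = phi \o (fun h : R => h * (j == i)%:R + x 0 j));
  last first.
  by apply/funext => h /=; rewrite !mxE eqxx.
have dlin : is_derive (0 : R) 1 (fun h : R => h * (j == i)%:R + x 0 j) (j == i)%:R.
  rewrite (_ : (fun h : R => _) = (j == i)%:R \*: id + cst (x 0 j)); last first.
    by apply/funext => h /=; rewrite mulrC.
  by apply: is_derive_eq; rewrite addr0 [_ *: _]mulr1.
have dphi' : is_derive ((fun h : R => h * (j == i)%:R + x 0 j) 0) 1 phi l.
  by rewrite mul0r add0r.
rewrite mulrC.
exact: (@is_derive1_comp _ phi (fun h : R => h * (j == i)%:R + x 0 j) _ _ _ dphi'
  dlin).
Qed.

Lemma set_coord_sin x i j : sin (set_coord x i (- pi) 0 j) = sin (set_coord x i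
  pi 0 j) :> R.
Proof. by rewrite !mxE; case: eqP => // _; rewrite sinN sinpi oppr0. Qed.

Lemma set_coord_cos x i j : cos (set_coord x i (- pi) 0 j) = cos (set_coord x i
  pi 0 j) :> R.
Proof. by rewrite !mxE; case: eqP => // _; rewrite cosN. Qed.

Lemma pderiv_sin i : pderiv i (fun x => sin (x 0 i)) (fun x => cos (x 0 i)).
Proof.
split; [exact: bcont_sin|exact: bcont_cos|by move=> j x _; exact: set_coord_sin|].
by move=> x _; apply: (is_derive_eq (is_derive_coord i (is_derive_sin (x 0 i))));
  rewrite eqxx mul1r.
Qed.

Lemma sin2_half (a : R) : sin (a / 2) ^+ 2 = (1 - cos a) / 2.
Proof.
have {2}-> : a = a / 2 *+ 2 by rewrite -mulr_natr divfK.
by rewrite cos_mulr2n cos2sin2 -mulr_natr; field.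
Qed.

Lemma omegaE : omega = (fun x : rV => \sum_i (1 - cos (x 0 i)) / 2).
Proof. by apply/funext => x; apply: eq_bigr => i _; exact: sin2_half. Qed.

Lemma omega_ge0 x : 0 <= omega x.
Proof. by apply: sumr_ge0 => i _; exact: sqr_ge0. Qed.

Lemma omega_le x : omega x <= d%:R.
Proof.
rewrite omegaE (le_trans (y := \sum_(i < d) 1))//;
  last by rewrite sumr_const card_ord.
by apply: ler_sum => i _; have := cos_geN1 (x 0 i); lra.
Qed.

Lemma pderiv_omega i : pderiv i omega (fun x => sin (x 0 i) / 2).
Proof.
have com : bcont (omega : rV -> R).
  rewrite omegaE; apply: bcont_sum => j; under eq_fun do rewrite mulrC.
  by apply: bcontZ; apply: bcontB; [exact: bcont_cst|exact: bcont_cos].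
split => //.
- by under eq_fun do rewrite mulrC; apply: bcontZ; exact: bcont_sin.
- by move=> j x _; rewrite omegaE; apply: eq_bigr => k _; rewrite set_coord_cos.
move=> x _; rewrite omegaE.
have dj j : is_derive x (delta_mx 0 i) (fun y : rV => (1 - cos (y 0 j)) / 2)
    ((j == i)%:R * (sin (x 0 j) / 2)).
  apply: (@is_derive_coord _ _ _ (fun s => (1 - cos s) / 2)).
  rewrite (_ : (fun s : R => _) = 2^-1 \*: (cst 1 - cos)); last first.
    by apply/funext => s /=; rewrite mulrC.
  by apply: is_derive_eq; rewrite sub0r opprK [_ *: _]mulrC.
rewrite (_ : (fun y : rV => _) = \sum_(j < d) (fun y : rV => (1 - cos (y 0 j)) /
  2)); last first.
  by apply/funext => y; rewrite fct_sumE.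
apply: (is_derive_eq (is_derive_sum dj));
  rewrite (bigD1 i)//= eqxx mul1r big1 ?addr0// => j ji.
by rewrite (negbTE ji) mul0r.
Qed.

Section Regularised.
Variables (del : R) (del0 : 0 < del) (del1 : del < 1) (d0 : (0 < d)%N).

(** For 0 < del < 1 the weight is positive and omega <= wreg <= d; its inverse vreg is
smooth and increases to 1 / omega as del decreases to 0. The interpolation
with the constant d, rather than the addition of a constant, preserves the
bound by d used at each step of the recursions. *)
Definition wreg x : R := (1 - del) * omega x + del * d%:R.
Definition vreg x : R := (wreg x)^-1.

Let dR0 : 0 < d%:R :> R. Proof. by rewrite ltr0n. Qed.

Lemma wreg_ge x : del * d%:R <= wreg x.
Proof. by rewrite /wreg lerDr mulr_ge0 ?omega_ge0// subr_ge0 ltW. Qed.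

Lemma wreg_gt0 x : 0 < wreg x.
Proof. by apply: lt_le_trans (wreg_ge x); exact: mulr_gt0. Qed.

Lemma wreg_le x : wreg x <= d%:R.
Proof. by have := omega_le x; have l0 := del0; have l1 := del1; rewrite /wreg;
  nra. Qed.

Lemma omega_le_wreg x : omega x <= wreg x.
Proof. by have := omega_le x; have l0 := del0; have l1 := del1; rewrite /wreg;
  nra. Qed.

Lemma vreg_gt0 x : 0 < vreg x. Proof. by rewrite invr_gt0 wreg_gt0. Qed.

Lemma vreg_wreg x : vreg x * wreg x = 1.
Proof. by rewrite mulVf// gt_eqF// wreg_gt0. Qed.

Lemma bcont_vreg : bcont vreg.
Proof.
split.
  move=> x; have Wn0 : wreg x != 0 by rewrite gt_eqF// wreg_gt0.
  have [com _ _ _] := @pderiv_omega (Ordinal d0).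
  have [cW _] : bcont wreg by apply: bcontD; [exact: bcontZ|exact: bcont_cst].
  exact: (cvgV Wn0 (cW x)).
exists (del * d%:R)^-1 => x; rewrite (ger0_norm (ltW (vreg_gt0 x))).
by rewrite /vreg lef_pV2 ?posrE ?wreg_ge ?wreg_gt0// mulr_gt0.
Qed.

Lemma pderiv_vreg i : pderiv i vreg (fun x => - (1 - del) / 2 * vreg x ^+ 2 * sin
  (x 0 i)).
Proof.
have [com cs po dom] := pderiv_omega i.
split; first exact: bcont_vreg.
- by apply: bcontM; [apply: bcontZ; apply: bcontX;
  exact: bcont_vreg|exact: bcont_sin].
- by move=> j x cx; rewrite /vreg /wreg po.
move=> x cx; have domx := dom x cx.
have dW : is_derive x (delta_mx 0 i) wreg ((1 - del) * (sin (x 0 i) / 2)).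
  rewrite (_ : wreg = (1 - del) \*: omega + cst (del * d%:R)); last by [].
  by apply: is_derive_eq; rewrite addr0.
have Wn0 : wreg x != 0 by rewrite gt_eqF// wreg_gt0.
have [dWx vW] := dW; split; first exact: derivableV.
have sE (a b : R) : a *: b = a * b by [].
by rewrite deriveV// vW /vreg sE exprVn; field.
Qed.

Lemma pderiv_vregX i n : pderiv i (fun x => vreg x ^+ n)
  (fun x => - (n%:R * (1 - del) / 2) * vreg x ^+ n.+1 * sin (x 0 i)).
Proof.
apply: (pderiv_eq (pderivX n (pderiv_vreg i))); apply/funext => x.
case: n => [|n] /=; first by rewrite !mul0r oppr0 !mul0r.
by rewrite [vreg x ^+ n.+2]exprSr [vreg x ^+ n.+1]exprSr; field.
Qed.

End Regularised.
End Weights.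

(** * Hardy and Rellich inequalities with remainder *)

Section RegularisedInequalities.
Context {R : realType} {d : nat}.
Local Notation rV := 'rV[R]_d.
Variables (del : R) (del0 : 0 < del) (del1 : del < 1) (d0 : (0 < d)%N).
Implicit Types (x : rV) (i : 'I_d).

Local Notation vreg := (@vreg R d del).
Local Notation wreg := (@wreg R d del).

Let D : R := d%:R.

Let D0 : 0 < D. Proof. by rewrite ltr0n. Qed.

Let y i x : R := (1 - cos (x 0 i)) / 2.

Let om_y x : omega x = \sum_i y i x. Proof. by rewrite omegaE. Qed.

Let T x : R := \sum_i y i x ^+ 2.

Let om2 x : omega x ^+ 2 <= D * T x.
Proof. by rewrite om_y; exact: sum_sqr_le. Qed.

Let sum_sin2 x : \sum_i sin (x 0 i) ^+ 2 = 4 * (omega x - T x).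
Proof.
rewrite om_y /T -sumrB mulr_sumr; apply: eq_bigr => i _.
by rewrite /y sin2cos2; field.
Qed.

Let sum_cos x : \sum_i cos (x 0 i) = D - 2 * omega x.
Proof.
have -> : D = \sum_(i < d) 1 by rewrite sumr_const card_ord.
rewrite om_y mulr_sumr -sumrB.
by apply: eq_bigr => i _; rewrite /y; field.
Qed.

Let Wle x : 0 <= omega x <= D. Proof. by rewrite omega_ge0 omega_le. Qed.

Let bcont_vregX n : bcont (fun x => vreg x ^+ n).
Proof. by apply: bcontX; exact: bcont_vreg. Qed.

Variables (u : rV -> R) (u1 u2 : 'I_d -> rV -> R).
Hypothesis du : forall i, pderiv i u (u1 i).
Hypothesis ddu : forall i, pderiv i (u1 i) (u2 i).

Let cu : bcont u. Proof. by case: (du (Ordinal d0)). Qed.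
Let cu1 i : bcont (u1 i). Proof. by case: (ddu i). Qed.
Let cu2 i : bcont (u2 i). Proof. by case: (ddu i). Qed.

Definition mass (f : rV -> R) p : R := cint (fun x => f x ^+ 2 * vreg x ^+ p).

Let bcont_mass f p : bcont f -> bcont (fun x => f x ^+ 2 * vreg x ^+ p).
Proof. by move=> cf; apply: bcontM => //; exact: bcontX. Qed.

Let bcont_sum_mass (f : 'I_d -> rV -> R) p : (forall i, bcont (f i)) ->
  bcont (fun x => \sum_i f i x ^+ 2 * vreg x ^+ p).
Proof. by move=> cf; apply: bcont_sum => i; exact: bcont_mass. Qed.

Lemma sum_mass (f : 'I_d -> rV -> R) p : (forall i, bcont (f i)) ->
  \sum_i mass (f i) p = cint (fun x => \sum_i f i x ^+ 2 * vreg x ^+ p).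
Proof. by move=> cf; rewrite cint_sum// => i; exact: bcont_mass. Qed.

(** The i-th term of the divergence of u^2 vreg^p (sin x_1, ..., sin x_d). The
vector (sin x_j) is twice the gradient of omega and plays the role that x has
in the Euclidean Hardy inequality. *)
Let hardy_div p i x : R :=
  (u1 i x * u x + u x * u1 i x) * (vreg x ^+ p * sin (x 0 i)) + u x * u x *
  (- (p%:R * (1 - del) / 2) * vreg x ^+ p.+1 * sin (x 0 i) * sin (x 0 i)
   + vreg x ^+ p * cos (x 0 i)).

Let pderiv_hardy_div p i : pderiv i (fun x => u x * u x * (vreg x ^+ p * sin (x 0
  i))) (hardy_div p i).
Proof.
apply: pderivM; first by apply: pderivM.
apply: pderivM; [exact: pderiv_vregX|exact: pderiv_sin].
Qed.

Let bcont_hardy_div p i : bcont (hardy_div p i).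
Proof. by case: (pderiv_hardy_div p i). Qed.

(** The divergence of u^2 vreg^(n+1) (sin x_j) has integral 0. Its cross term is
bounded below, coordinate by coordinate, by completing a square, with e / 8
chosen to take half of the coefficient e of u^2 vreg^(n+1). What remains is
[hardy_scalar]. *)
Lemma hardy_step n : (2 * n + 2 < d)%N ->
  mass u n.+1 <= A1 R (- n%:Z) d * \sum_i mass (u1 i) n
                 + A2 R (- n%:Z) d * mass u n.
Proof.
move=> hd; have l0 := del0; have l1 := del1; have D0' := D0.
have hD : 2 * n%:R + 3 <= D by rewrite /D -!natrM -natrD ler_nat; lia.
have n0 : 0 <= n%:R :> R by [].
pose e : R := D - 2 * n%:R - 2.
have e0 : 0 < e by rewrite /e; lra.
rewrite A1N A2N -/D -/e sum_mass//.
suff : 0 <= cint (fun x => \sum_i hardy_div n.+1 i x + (8 / e * (\sum_i u1 i x ^+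
  2 * vreg x ^+ n)
   + ((3 * D - 2 * n%:R - 2) / (2 * D) * (u x ^+ 2 * vreg x ^+ n)
      - e / 2 * (u x ^+ 2 * vreg x ^+ n.+1)))).
  have cF : bcont (fun x => \sum_i hardy_div n.+1 i x) by exact: bcont_sum.
  have cS := bcont_sum_mass n cu1; have c1 := bcont_mass n cu;
    have c2 := bcont_mass n.+1 cu.
  have c3 := bcontZ (8 / e) cS.
  have c4 := bcontZ ((3 * D - 2 * n%:R - 2) / (2 * D)) c1;
    have c5 := bcontZ (e / 2) c2.
  have c6 := bcontB c4 c5.
  rewrite (cintD cF (bcontD c3 c6)) (cintD c3 c6) (cintB c4 c5) !cintZ//.
  rewrite cint_sum// big1 ?add0r; last by move=> i _;
    exact: cint_pderiv (pderiv_hardy_div _ _).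
  rewrite -/(mass u n) -/(mass u n.+1); set b := cint _ => h.
  have E : 2 / e * (8 / e * b + ((3 * D - 2 * n%:R - 2) / (2 * D) * mass u n - e
    / 2 * mass u n.+1))
    = 16 / e ^+ 2 * b + (3 * D - 2 * n%:R - 2) / (D * e) * mass u n - mass u n.+1.
    by field; rewrite !gt_eqF.
  by rewrite -subr_ge0 -E mulr_ge0// divr_ge0// ltW.
apply: cint_ge0 => x _.
have Vx := vreg_gt0 del0 del1 d0 x; have VWx := vreg_wreg del0 del1 d0 x.
have VW1 : wreg x = (1 - del) * omega x + del * D by [].
have := hardy_scalar (e := 2 * n%:R + 2) (T := T x) (om := omega x) (del := del) D0.
rewrite -VW1 => /(_ ltac:(lra) ltac:(lra) (Wle x) (om2 x)).
have Wx : wreg x = (vreg x)^-1 by rewrite /vreg invrK.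
set Vx1 := vreg x in Vx VWx Wx *; set w := wreg x in VWx Wx *.
set o := omega x; set t := T x => key.
have per i : - (8 / e) * u1 i x ^+ 2 - e / 8 * u x ^+ 2 * Vx1 ^+ 2 * sin (x 0 i)
  ^+ 2
    <= 2 * u x * u1 i x * Vx1 * sin (x 0 i).
  rewrite -subr_ge0 (_ : _ - _ = (8 / e) * (u1 i x + e / 8 * (u x * Vx1 * sin (x
    0 i))) ^+ 2).
    by rewrite mulr_ge0 ?sqr_ge0// divr_ge0// ltW.
  by field; rewrite gt_eqF.
have step1 : \sum_i hardy_div n.+1 i x >= Vx1 ^+ n * (- (8 / e) * (\sum_i u1 i x
  ^+ 2)
   + u x ^+ 2 * (Vx1 * (D - 2 * o) - ((e / 8) + n.+1%:R * (1 - del) / 2) * Vx1 ^+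
     2 * (4 * (o - t)))).
  rewrite /o /t -sum_sin2 -sum_cos.
  rewrite [X in X <= _](_ : _ = \sum_i Vx1 ^+ n * (- (8 / e) * u1 i x ^+ 2 +
     u x ^+ 2 * (Vx1 * cos (x 0 i) - (e / 8 + n.+1%:R * (1 - del) / 2) * Vx1 ^+ 2
       * sin (x 0 i) ^+ 2))); last first.
    by rewrite -mulr_sumr big_split/= -mulr_sumr -mulr_sumr sumrB -!mulr_sumr.
  apply: ler_sum => i _; rewrite /hardy_div -/Vx1 [Vx1 ^+ n.+2]exprSr [Vx1 ^+
    n.+1]exprSr.
  rewrite -subr_ge0; have := per i; rewrite -subr_ge0 => hper.
  set z := (X in 0 <= X) in hper.
  rewrite (_ : _ - _ = Vx1 ^+ n * z); first by rewrite mulr_ge0// exprn_ge0// ltW.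
  by rewrite /z; ring.
rewrite -mulr_suml.
suff fin : 0 <= u x ^+ 2 * (Vx1 * (D - 2 * o) - ((e / 8) + n.+1%:R * (1 - del) /
  2) * Vx1 ^+ 2 * (4 * (o - t))
    + (3 * D - 2 * n%:R - 2) / (2 * D) - e / 2 * Vx1).
  have : 0 <= Vx1 ^+ n * (u x ^+ 2 * (Vx1 * (D - 2 * o) - ((e / 8) + n.+1%:R * (1
    - del) / 2) * Vx1 ^+ 2 * (4 * (o - t))
    + (3 * D - 2 * n%:R - 2) / (2 * D) - e / 2 * Vx1)).
    by rewrite mulr_ge0// exprn_ge0// ltW.
  move=> h; apply: (le_trans h); rewrite -lerBlDr; apply: (le_trans _ step1).
  rewrite [Vx1 ^+ n.+1]exprSr le_eqVlt; apply/orP; left; apply/eqP; ring.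
rewrite mulr_ge0 ?sqr_ge0//.
rewrite (_ : _ - _ = Vx1 ^+ 2 * (w * (D - 2 * o) -
           ((D - (2 * n%:R + 2)) / 2 + (1 - del) * (2 * n%:R + 2)) * (o - t) +
           (3 * D - (2 * n%:R + 2)) / (2 * D) * w ^+ 2 -
           (D - (2 * n%:R + 2)) / 2 * w)).
  by rewrite mulr_ge0 ?sqr_ge0.
by rewrite /e Wx -[n.+1%:R]natr1; field; rewrite !gt_eqF.
Qed.


(** The i-th term of the divergence of u vreg^q grad u. *)
Let green_div q i x : R :=
  (u1 i x * u1 i x + u x * u2 i x) * vreg x ^+ q + u x * u1 i x *
  (- (q%:R * (1 - del) / 2) * vreg x ^+ q.+1 * sin (x 0 i)).

Let pderiv_green_div q i : pderiv i (fun x => u x * u1 i x * vreg x ^+ q)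
  (green_div q i).
Proof. by apply: pderivM; [exact: pderivM|exact: pderiv_vregX]. Qed.

Let bcont_green_div p i : bcont (green_div p i).
Proof. by case: (pderiv_green_div p i). Qed.

(** Green's identity for u vreg^q grad u leaves a multiple of u vreg^(q+1) times
the derivative of u along (sin x_j), which a multiple of the Hardy field
removes. The result bounds
the gradient term and a positive multiple of the mass at q + 1 by
- u Lap u vreg^q and a lower-order term; Young with parameter rho and
[hardy_step] at q = n + 1 turn this into the claim, the coefficients of the
mass adding up to rho. *)
Lemma rellich_step n : (2 * n + 4 < d)%N ->
  rho R n d ^+ 2 * mass u n.+2 <=
  mass (fun x => \sum_i u2 i x) n + 2 * rho R n d * err R n d * mass u n.+1.
Proof.
move=> hd; have l0 := del0; have l1 := del1; have D0' := D0.
have hD : 2 * n%:R + 5 <= D by rewrite /D -!natrM -natrD ler_nat; lia.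
have n0 : 0 <= n%:R :> R by [].
have r0 := rho_gt0 R n d hd.
pose q : R := n%:R + 1.
have cL : bcont (fun x => \sum_i u2 i x) by exact: bcont_sum.
have cS := bcont_sum_mass n.+1 cu1.
have c1 := bcont_mass n.+1 cu; have c2 := bcont_mass n.+2 cu;
  have cN := bcont_mass n cL.
pose r := rho R n d.
(* Green's identity and Young; the Hardy inequality comes in afterwards. *)
have main : 0 <= - (\sum_i mass (u1 i) n.+1)
   + (q / 2 * (1 - (q + 1) / D) * mass u n.+1
      - (q / 4 * (D - 2 * q - 2) - r / 2) * mass u n.+2)
   + (2 * r)^-1 * mass (fun x => \sum_i u2 i x) n.
  rewrite sum_mass//.
  have cF : bcont (fun x => \sum_i green_div n.+1 i x) by exact: bcont_sum.
  have cG : bcont (fun x => \sum_i hardy_div n.+2 i x) by exact: bcont_sum.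
  have cG' := bcontZ (q / 4 * (1 - del)) cG.
  have cFG := bcontD cF cG'.
  have c3 := bcontN cS.
  have c4 := bcontZ (q / 2 * (1 - (q + 1) / D)) c1.
  have c5 := bcontZ (q / 4 * (D - 2 * q - 2) - r / 2) c2.
  have c6 := bcontB c4 c5; have c7 := bcontZ (2 * r)^-1 cN.
  have c8 := bcontD c3 c6; have c9 := bcontD c8 c7.
  have I0 : cint (fun x => \sum_i green_div n.+1 i x + q / 4 * (1 - del) * \sum_i
    hardy_div n.+2 i x) = 0.
    rewrite cintD// cintZ// !cint_sum// !big1 ?mulr0 ?addr0//.
      by move=> i _; exact: cint_pderiv (pderiv_hardy_div _ _).
    by move=> i _; exact: cint_pderiv (pderiv_green_div _ _).
  suff : 0 <= cint (fun x => (\sum_i green_div n.+1 i x + q / 4 * (1 - del) *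
    \sum_i hardy_div n.+2 i x) +
     ((- (\sum_i u1 i x ^+ 2 * vreg x ^+ n.+1)
     + (q / 2 * (1 - (q + 1) / D) * (u x ^+ 2 * vreg x ^+ n.+1)
      - (q / 4 * (D - 2 * q - 2) - r / 2) * (u x ^+ 2 * vreg x ^+ n.+2)))
     + (2 * r)^-1 * ((\sum_i u2 i x) ^+ 2 * vreg x ^+ n))).
    rewrite (cintD cFG c9) I0 add0r (cintD c8 c7) (cintD c3 c6) (cintB c4 c5)
      !cintZ//.
    suff -> : cint (fun x => - (\sum_i u1 i x ^+ 2 * vreg x ^+ n.+1)) =
       - cint (fun x => \sum_i u1 i x ^+ 2 * vreg x ^+ n.+1) by [].
    by rewrite -mulN1r -cintZ//; congr cint; apply/funext => x; rewrite mulN1r.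
  apply: cint_ge0 => x _.
  have Vx := vreg_gt0 del0 del1 d0 x; have VWx := vreg_wreg del0 del1 d0 x.
  have VW1 : wreg x = (1 - del) * omega x + del * D by [].
  have := rellich_scalar (g := 2 * (q + 1)) (T := T x) (om := omega x) (del :=
    del) D0.
  rewrite -VW1 => /(_ ltac:(rewrite /q; lra) ltac:(lra) (Wle x) (om2 x)).
  have Wx : wreg x = (vreg x)^-1 by rewrite /vreg invrK.
  set v := vreg x in Vx VWx Wx *; set w := wreg x in VWx Wx *.
  set o := omega x; set t := T x => key.
  set L := \sum_i u2 i x; set S := \sum_i u1 i x ^+ 2 * v ^+ n.+1.
  have -> : \sum_i green_div n.+1 i x + q / 4 * (1 - del) * \sum_i hardy_div n.+2
    i x =
     S + u x * L * v ^+ n.+1 + q / 4 * (u x ^+ 2 * v ^+ n * v ^+ 3 *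
       ((1 - del) * (w * (D - 2 * o) - 2 * (q + 1) * (1 - del) * (o - t)))).
    pose Z := \sum_i u1 i x * sin (x 0 i).
    have -> : \sum_i green_div n.+1 i x =
        S + u x * v ^+ n.+1 * L + - (q * (1 - del) / 2) * u x * v ^+ n.+2 * Z.
      rewrite /S /L /Z !mulr_sumr -!big_split/=; apply: eq_bigr => i _.
      by rewrite /green_div -/v -[n.+1%:R]natr1 -/q; ring.
    have -> : \sum_i hardy_div n.+2 i x = 2 * u x * v ^+ n.+2 * Z
        + u x ^+ 2 * v ^+ n.+2 * (D - 2 * o)
        + - ((q + 1) * (1 - del) / 2) * u x ^+ 2 * v ^+ n.+3 * (4 * (o - t)).
      rewrite /Z /o /t -sum_sin2 -sum_cos !mulr_sumr -!big_split/=;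
        apply: eq_bigr => i _.
      by rewrite /hardy_div -/v -[n.+2%:R]natr1 -[n.+1%:R]natr1 -/q; ring.
    rewrite [v ^+ n.+3]exprSr [v ^+ n.+2]exprSr [v ^+ n.+1]exprSr Wx; field.
    by rewrite gt_eqF.
  have vn : 0 <= v ^+ n by rewrite exprn_ge0// ltW.
  have q0 : 0 <= q / 4 by rewrite /q; lra.
  have c0 : 0 <= q / 4 * (u x ^+ 2 * v ^+ n * v ^+ 3).
    have v3 : 0 <= v ^+ 3 by rewrite exprn_ge0// ltW.
    have uu : 0 <= u x ^+ 2 by exact: sqr_ge0.
    by do 2 (apply: mulr_ge0 => //); exact: mulr_ge0.
  have k1 := ler_wpM2l c0 key.
  have k2 : 0 <= (2 * r)^-1 * (L + r * (u x * v)) ^+ 2 * v ^+ n.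
    by do 2 (apply: mulr_ge0 => //);
      [rewrite invr_ge0 mulr_ge0// ltW|exact: sqr_ge0].
  rewrite -subr_ge0 in k1.
  have := addr_ge0 k1 k2.
  rewrite [v ^+ n.+2]exprSr [v ^+ n.+1]exprSr Wx; congr (_ <= _).
  by field; rewrite !gt_eqF.
have hs := hardy_step (n := n.+1) ltac:(lia).
move: hs main; rewrite A1N A2N -/D -[n.+1%:R]natr1 -/q.
set b := \sum_i _; set a1 := mass u n.+1; set a2 := mass u n.+2; set L := mass _ n.
have rE : r = (D + 2 * n%:R) * (D - 2 * n%:R - 4) / 16 by [].
have eE : err R n d = q * (D - n%:R - 2) / (2 * D) + (D - 2 * n%:R - 4) * (3 * D
  - 2 * n%:R - 4) / (16 * D) by [].
rewrite -/r in r0 *; move=> hs main.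
pose e := D - 2 * n%:R - 4; have e0 : 0 < e by rewrite /e; lra.
have qe : D - 2 * q - 2 = e by rewrite /q /e; ring.
rewrite qe in hs main.
have {}hs : 0 <= b + e ^+ 2 / 16 * ((3 * D - 2 * q - 2) / (D * e) * a1 - a2).
  rewrite (_ : b + _ = e ^+ 2 / 16 * (16 / e ^+ 2 * b + (3 * D - 2 * q - 2) / (D
    * e) * a1 - a2)).
    by apply: mulr_ge0; [apply: divr_ge0 => //; exact: sqr_ge0|rewrite subr_ge0].
  by field; rewrite !gt_eqF.
rewrite -subr_ge0.
rewrite (_ : _ - _ = 2 * r * ((b + e ^+ 2 / 16 * ((3 * D - 2 * q - 2) / (D * e) *
  a1 - a2))
  + (- b + (q / 2 * (1 - (q + 1) / D) * a1 - (q / 4 * e - r / 2) * a2) + (2 *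
    r)^-1 * L))).
  have r2 : 0 <= 2 * r by apply: mulr_ge0 => //; exact: ltW.
  by apply: mulr_ge0 => //; exact: addr_ge0.
have e0' : D - 2 * n%:R - 4 != 0 by rewrite gt_eqF.
have D2 : D + 2 * n%:R != 0 by rewrite gt_eqF//; lra.
by rewrite eE rE /e /q; field; rewrite e0' D2 gt_eqF.
Qed.

End RegularisedInequalities.

(** * Iteration for a fixed regularisation *)

Section Jets.
Context {R : realType} {d : nat}.
Local Notation rV := 'rV[R]_d.
Implicit Types (x : rV) (i j : 'I_d) (U : seq 'I_d -> rV -> R).

(** A function together with all its iterated partial derivatives, indexed by
words. The functions are defined everywhere, whereas the derivatives of psi
exist only in the open cube. *)
Definition jet U : Prop := forall w i, pderiv i (U w) (U (i :: w)).

(** The Laplacian acts at the innermost end of the word, so that the outer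
letters still differentiate it. *)
Definition lapJ U w x : R := \sum_i U (w ++ [:: i; i]) x.

Lemma pderiv_sum i (f g : 'I_d -> rV -> R) : (forall j, pderiv i (f j) (g j)) ->
  pderiv i (fun x => \sum_j f j x) (fun x => \sum_j g j x).
Proof.
move=> h; split.
- by apply: bcont_sum => j; case: (h j).
- by apply: bcont_sum => j; case: (h j).
- by move=> k x cx; apply: eq_bigr => j _; case: (h j) => _ _ pf _; exact: pf.
move=> x cx.
have dj j : is_derive x (delta_mx 0 i) (f j) (g j x) by case: (h j) => _ _ _; exact.
rewrite (_ : (fun _ => _) = \sum_(j < d) f j); first exact: is_derive_sum.
by apply/funext => y; rewrite fct_sumE.
Qed.

Lemma jet_lap U : jet U -> jet (lapJ U).
Proof. by move=> jU w i; apply: pderiv_sum => j; exact: (jU (w ++ [:: j;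
  j]) i). Qed.

Lemma jet_iter_lap U m : jet U -> jet (iter m lapJ U).
Proof. by move=> jU; elim: m => //= m IH; exact: jet_lap. Qed.

Variable (d0 : (0 < d)%N).

Lemma jet_bcont U w : jet U -> bcont (U w).
Proof. by move=> jU; case: (jU w (Ordinal d0)). Qed.

Lemma cint_lap U : jet U -> cint (lapJ U [::]) = 0.
Proof.
move=> jU; rewrite cint_sum; last by move=> i; exact: jet_bcont.
by rewrite big1// => i _; exact: (cint_pderiv (jU [:: i] i)).
Qed.

Lemma cint_iter_lap U m : jet U -> cint (U [::]) = 0 -> cint (iter m lapJ U [::])
  = 0.
Proof. by move=> jU U0; case: m => //= m; apply: cint_lap; exact: jet_iter_lap. Qed.

Variables (del : R) (del0 : 0 < del) (del1 : del < 1).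

Local Notation mass := (@mass R d del).

Lemma mass_ge0 f n : 0 <= mass f n.
Proof.
by apply: cint_ge0 => x _; rewrite mulr_ge0 ?sqr_ge0// exprn_ge0// ltW// vreg_gt0.
Qed.

Lemma mass0 f : mass f 0 = cint (fun x => f x ^+ 2).
Proof. by congr cint; apply/funext => x; rewrite expr0 mulr1. Qed.

Lemma mass_mono f n : bcont f -> mass f n <= d%:R * mass f n.+1.
Proof.
move=> cf; have cV n' : bcont (fun x : rV => f x ^+ 2 * vreg del x ^+ n').
  by apply: bcontM; [exact: bcontX|apply: bcontX; exact: bcont_vreg].
rewrite -cintZ//; apply: le_cint => //; first exact: bcontZ.
move=> x _; have Vx := vreg_gt0 del0 del1 d0 x.
have h : 1 <= d%:R * vreg del x.
  by rewrite -[leLHS](vreg_wreg del0 del1 d0 x) mulrC ler_pM2r// wreg_le.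
rewrite [X in _ <= X](_ : _ = f x ^+ 2 * vreg del x ^+ n * (d%:R * vreg del x));
  last first.
  by rewrite [vreg del x ^+ n.+1]exprSr; ring.
by rewrite ler_peMr// mulr_ge0 ?sqr_ge0// exprn_ge0// ltW.
Qed.

Definition grad U n : R := \sum_i mass (U [:: i]) n.

Lemma grad_mono U n : jet U -> grad U n <= d%:R * grad U n.+1.
Proof. by move=> jU; rewrite mulr_sumr; apply: ler_sum => i _; apply: mass_mono;
  exact: jet_bcont. Qed.

Lemma jet_poincare U : jet U -> cint (U [::]) = 0 -> mass (U [::]) 0 <= grad U 0.
Proof.
move=> jU U0; rewrite mass0 /grad (eq_bigr _ (fun i _ => mass0 _)).
apply: cint_poincare => //.
- exact: jet_bcont.
- by move=> i; exact: jet_bcont.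
- by case: (jU [::] (Ordinal d0)).
- by move=> i; case: (jU [::] i).
Qed.

(** Green's identity, Young, and the Poincare inequality for u. *)
Lemma grad_le_lap U : jet U -> cint (U [::]) = 0 -> grad U 0 <= mass (lapJ U
  [::]) 0.
Proof.
move=> jU U0; have P := jet_poincare jU U0.
have cU w : bcont (U w) by exact: jet_bcont.
have cL : bcont (lapJ U [::]) by apply: jet_bcont; exact: jet_lap.
have c1 i : bcont (fun x => U [:: i] x ^+ 2) by exact: bcontX.
have cUL : bcont (fun x => U [::] x * lapJ U [::] x) by exact: bcontM.
have green : grad U 0 + cint (fun x => U [::] x * lapJ U [::] x) = 0.
  rewrite /grad (eq_bigr _ (fun i _ => mass0 _)) -cint_sum// -cintD//;
    last exact: bcont_sum.
  have c2 i : bcont (fun x => U [:: i] x * U [:: i] x + U [::] x * U [:: i; i] x).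
    by apply: bcontD; exact: bcontM.
  transitivity (\sum_i cint (fun x => U [:: i] x * U [:: i] x + U [::] x * U [::
    i; i] x)).
    rewrite -cint_sum//; congr cint; apply/funext => x.
    by rewrite mulr_sumr -big_split/=; apply: eq_bigr => i _; rewrite expr2.
  by rewrite big1// => i _; apply: (cint_pderiv (pderivM (jU [::] i) (jU [:: i]
    i))).
have : 0 <= cint (fun x => 2^-1 * (U [::] x ^+ 2) + (2^-1 * (lapJ U [::] x ^+ 2)
  + U [::] x * lapJ U [::] x)).
  apply: cint_ge0 => x _; rewrite (_ : _ + _ = 2^-1 * (U [::] x + lapJ U [::] x)
    ^+ 2).
    by rewrite mulr_ge0 ?sqr_ge0.
  by field.
have c3 : bcont (fun x => 2^-1 * (U [::] x ^+ 2)) by apply: bcontZ; exact: bcontX.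
have c4 : bcont (fun x => 2^-1 * (lapJ U [::] x ^+ 2)) by apply: bcontZ;
  exact: bcontX.
rewrite (cintD c3 (bcontD c4 cUL)) (cintD c4 cUL) !cintZ;
  [|exact: bcontX|exact: bcontX].
rewrite -!mass0; move: P green.
by set a := mass _ _; set b := grad _ _; set c := mass _ _; set e := cint _; lra.
Qed.

(** Iterate [hardy_step] upwards in the exponent - n, using wreg <= d, and end with
the Poincare inequality at exponent 0: this is the recursion that defines
1 / H. *)
Lemma hardy_chain U n : (2 * n + 2 < d)%N -> jet U -> cint (U [::]) = 0 ->
  mass (U [::]) n.+1 <= (hardy R (- n%:Z) d)^-1 * grad U n.
Proof.
move=> hd jU U0; have dR0 : 0 < d%:R :> R by rewrite ltr0n.
have A20 n' : (2 * n' + 2 < d)%N -> 0 <= A2 R (- n'%:Z) d.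
  move=> hd'; have : 2 * n'%:R + 2 <= d%:R :> R by rewrite -!natrM -natrD
    ler_nat; lia.
  have n0 : 0 <= n'%:R :> R by [].
  by rewrite A2N => h; apply: divr_ge0; [lra|apply: mulr_ge0; lra].
elim: n hd => [|n IH] hd.
  have := hardy_step del0 del1 d0 (jU [::]) (fun i => jU [:: i] i) hd.
  rewrite oppr0 hardyV chain_sum0 mulrDl => /le_trans; apply.
  by have := A20 0%N hd; rewrite oppr0 => A0;
    rewrite lerD2l ler_wpM2l// jet_poincare.
have := hardy_step del0 del1 d0 (jU [::]) (fun i => jU [:: i] i) hd.
move/le_trans; apply; rewrite hardyVS mulrDl lerD2l -/(grad U n.+1).
have A0 := A20 _ hd; move: A0; set a2 := A2 _ _ _ => A0.
set h := (hardy _ _ _)^-1; rewrite (_ : d%:R * a2 * h * _ = a2 * (d%:R * (h *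
  grad U n.+1))); last by ring.
apply: ler_wpM2l => //; rewrite /h {h}.
have hd' : (2 * n + 2 < d)%N by lia.
apply: (le_trans (IH hd')); rewrite mulrCA ler_wpM2l ?grad_mono//.
by rewrite invr_ge0 ltW// hardy_gt0.
Qed.

(** The lower-order mass in [rellich_step] is the one that the Rellich inequality
with n - 1 controls, so it is absorbed by induction; at n = 0 the Hardy and
Poincare inequalities control it. *)
Lemma rellich_chain U n : (2 * n + 4 < d)%N -> jet U -> cint (U [::]) = 0 ->
  mass (U [::]) n.+1 <= cross R n d / 2 * mass (lapJ U [::]) n.
Proof.
move=> + jU U0; elim: n => [|n IH] hd.
  apply: (@le_trans _ _ ((hardy R 0 d)^-1 * mass (lapJ U [::]) 0)).
    have := @hardy_chain U 0%N ltac:(lia) jU U0; rewrite oppr0 => /le_trans; apply.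
    have H0 := hardy_gt0 R 0%N d ltac:(lia); rewrite oppr0 in H0.
    by rewrite ler_wpM2l ?grad_le_lap// invr_ge0 ltW.
  by rewrite ler_wpM2r ?mass_ge0// cross0.
have hd' : (2 * n + 4 < d)%N by lia.
have r0 := rho_gt0 R n d hd'; have e0 := err_ge0 R n d hd'.
have h1 := rellich_step del0 del1 d0 (jU [::]) (fun i => jU [:: i] i) hd'.
have h2 := IH hd'.
have cs := cross_step R n d ltac:(lia).
have cL : bcont (lapJ U [::]) by apply: jet_bcont; exact: jet_lap.
have mm := mass_mono n cL.
have L0 := mass_ge0 (lapJ U [::]) n.
have L1 := mass_ge0 (lapJ U [::]) n.+1.
have hd2 : (2 * n + 2 < d)%N by lia.
have X0 := cross_ge0 R n d hd2.
rewrite -[lapJ U [::]]/(fun x => \sum_i U [:: i; i] x) in h2 mm L0 L1 *.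
move: h1 h2 mm L0 L1 cs r0 e0 X0.
set L := (fun x => \sum_i U [:: i; i] x).
move: (mass _ n.+2) (mass _ n.+1) (mass L n) (mass L n.+1) => a2 a1 l0 l1.
move: (rho R n d) (err R n d) (cross R n d) (cross R n.+1 d) => r e X X'.
move=> h1 h2 mm L0 L1 cs r0 e0 X0.
have K0 : 0 <= 1 + 2 * r * e * (X / 2).
  by apply: addr_ge0 => //; do ?apply: mulr_ge0 => //; exact: ltW.
have h3 : r ^+ 2 * a2 <= (1 + 2 * r * e * (X / 2)) * l0.
  apply: (le_trans h1); rewrite [leRHS]mulrDl mul1r lerD2l -[leRHS]mulrA
    ler_wpM2l//.
  by do ?apply: mulr_ge0 => //; exact: ltW.
have h4 : a2 <= (1 + 2 * r * e * (X / 2)) * l0 / r ^+ 2.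
  by rewrite ler_pdivlMr ?exprn_gt0// mulrC.
apply: (le_trans h4).
apply: (@le_trans _ _ ((1 + 2 * r * e * (X / 2)) * (d%:R * l1) / r ^+ 2)).
  by rewrite ler_wpM2r ?invr_ge0 ?sqr_ge0// ler_wpM2l.
rewrite (_ : _ / r ^+ 2 = d%:R / r ^+ 2 * (1 + 2 * r * e * (X / 2)) * l1);
  last by field; rewrite gt_eqF.
by rewrite ler_wpM2r.
Qed.

Lemma rellich_ineq U n : (2 * n + 4 < d)%N -> jet U -> cint (U [::]) = 0 ->
  rellich R (- n%:Z) d * mass (U [::]) n.+2 <= mass (lapJ U [::]) n.
Proof.
move=> hd jU U0.
have r0 := rho_gt0 R n d hd; have e0 := err_ge0 R n d hd.
have h1 := rellich_step del0 del1 d0 (jU [::]) (fun i => jU [:: i] i) hd.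
have h2 := rellich_chain hd jU U0.
have [R0 hR] := rellich_bound R n d hd.
have L0 := mass_ge0 (lapJ U [::]) n; have M0 := mass_ge0 (U [::]) n.+2.
have hd2 : (2 * n + 2 < d)%N by lia.
have X0 := cross_ge0 R n d hd2.
rewrite -[lapJ U [::]]/(fun x => \sum_i U [:: i; i] x) in h2 L0 *.
move: h1 h2 R0 hR L0 M0 r0 e0 X0.
move: (mass _ n.+2) (mass _ n.+1) (mass _ n) => a2 a1 l0.
move: (rho R n d) (err R n d) (cross R n d) (rellich _ _ _) => r e X Re.
move=> h1 h2 R0 hR L0 M0 r0 e0 X0.
have K0 : 0 < 1 + 2 * r * e * (X / 2).
  by apply: ltr_pwDl => //; do ?apply: mulr_ge0 => //; exact: ltW.
have h3 : r ^+ 2 * a2 <= (1 + 2 * r * e * (X / 2)) * l0.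
  apply: (le_trans h1); rewrite [leRHS]mulrDl mul1r lerD2l -[leRHS]mulrA
    ler_wpM2l//.
  by do ?apply: mulr_ge0 => //; exact: ltW.
rewrite -(ler_pM2l K0) [leLHS]mulrA; apply: le_trans h3.
by rewrite ler_wpM2r// mulrC.
Qed.

(** Each Laplacian lowers the exponent by 2, and Lap^m u has zero average again,
being a sum of derivatives of periodic functions when m > 0. *)
Lemma even_ineq U m n : (2 * n + 4 * m < d)%N -> jet U -> cint (U [::]) = 0 ->
  0 <= C_even R m (- n%:Z) d /\
  C_even R m (- n%:Z) d * mass (U [::]) (n + 2 * m) <= mass (iter m lapJ U [::]) n.
Proof.
move=> + jU U0; elim: m n => [|m IH] n hd.
  by rewrite /C_even big_geq// mul1r muln0 addn0.
have [C0 hC] := IH n.+2 ltac:(lia).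
have hd' : (2 * n + 4 < d)%N by lia.
have [R0 _] := rellich_bound R n d hd'.
have E : C_even R m.+1 (- n%:Z) d = rellich R (- n%:Z) d * C_even R m (- n.+2%:Z) d.
  rewrite /C_even big_nat_recl//= mulr0 subr0; congr (_ * _).
  by apply: eq_big_nat => i _; congr (rellich _ _ _); lia.
rewrite E; split; first exact: mulr_ge0.
have -> : (n + 2 * m.+1 = n.+2 + 2 * m)%N by lia.
rewrite -mulrA; apply: (le_trans (ler_wpM2l R0 hC)).
by rewrite iterS; apply: rellich_ineq => //;
  [exact: jet_iter_lap|exact: cint_iter_lap].
Qed.

Lemma odd_ineq U m n : (2 * n + 4 * m + 2 < d)%N -> jet U -> cint (U [::]) = 0 ->
  0 <= C_odd R m (- n%:Z) d /\
  C_odd R m (- n%:Z) d * mass (U [::]) (n + 2 * m + 1) <= grad (iter m lapJ U) n.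
Proof.
move=> hd jU U0.
have hd' : (2 * n + 2 < d)%N by lia.
have H0 := hardy_gt0 R n d hd'.
have [C0 hC] := @even_ineq U m n.+1 ltac:(lia) jU U0.
have E : C_odd R m (- n%:Z) d = hardy R (- n%:Z) d * C_even R m (- n.+1%:Z) d.
  rewrite /C_odd /C_even; congr (_ * _).
  by apply: eq_big_nat => i _; congr (rellich _ _ _); lia.
rewrite E; split; first by rewrite mulr_ge0// ltW.
have -> : (n + 2 * m + 1 = n.+1 + 2 * m)%N by lia.
rewrite -mulrA; apply: (le_trans (ler_wpM2l (ltW H0) hC)).
rewrite -ler_pdivlMl//; apply: hardy_chain => //; first exact: jet_iter_lap.
exact: cint_iter_lap.
Qed.

End Jets.

(** * Removing the regularisation *)

Section Limit.
Context {R : realType} {d : nat}.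
Local Notation rV := 'rV[R]_d.
Local Notation mR := (measurableTypeR R).
Local Notation tr := (@tuple_row R d).
Variable (d0 : (0 < d)%N).
Implicit Types (x : rV) (F G : rV -> R).

Lemma omega_gt0 x : cube x -> (exists i, x 0 i != 0) -> 0 < omega x.
Proof.
move=> cx [i xi]; rewrite /omega (bigD1 i)//=.
apply: ltr_pwDl; last by apply: sumr_ge0 => j _; exact: sqr_ge0.
have pi0 := pi_gt0 R.
rewrite exprn_even_gt0//=; have /andP[x1 x2] := cx i.
have [xp|xn|x00] := ltgtP (x 0 i) 0; last by rewrite x00 eqxx in xi.
- rewrite -oppr_eq0 -sinN gt_eqF// sin_gt0_pi//; apply/andP; split; lra.
- rewrite gt_eqF// sin_gt0_pi//; apply/andP; split; lra.
Qed.

(** At x = 0, where omega vanishes, the negative powers of omega take the value 0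
and the comparison with the powers of vreg fails; the hyperplane that is removed
instead of the origin is null because a line has a null point. *)
Lemma axis_null : exists N : set (d.-tuple mR), [/\ measurable N,
  lebesgue_tuple R d N = 0%E & forall t, ~ N t -> exists i, tnth t i != 0].
Proof.
case: d d0 => // n _.
exists [set t | tnth t ord0 = 0]; split.
- rewrite (_ : [set _ | _] = (fun t => tnth t ord0) @^-1` [set (0 : mR)]);
  last by [].
  by rewrite -[X in measurable X]setTI; apply: measurable_tnth.
- rewrite -[LHS]/((@leb R \x lebesgue_tuple R n)%E (@Defs.cons_tuple R n @^-1`
  [set t | tnth t ord0 = 0])).
  rewrite (_ : _ @^-1` _ = [set (0 : mR)] `*` setT).
    rewrite product_measure1E// [X in (X * _)%E](_ : _ = 0%E) ?mul0e//.
    exact: lebesgue_measure_set1.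
  by apply/seteqP; split => -[s t] /=; rewrite tnth0; [split | case].
- by move=> t /= /eqP t0; exists ord0.
Qed.

Let mbox : measurable (box d : set (d.-tuple mR)).
Proof. exact (@measurable_box R d). Qed.

Lemma omega_bcont : bcont (omega : rV -> R).
Proof. by have [com _ _ _] := @pderiv_omega R d (Ordinal d0). Qed.

(** The inverse is measurable as the power function of exponent - 1, which agrees
with it at 0 too. *)
Lemma measurable_weighted F p : bcont F ->
  measurable_fun (box d) (fun t => (F (tr t) * (omega (tr t)) ^- p)%:E).
Proof.
move=> cF; apply/measurable_EFinP; apply: measurable_funTS.
have [mF _] := bcont_bmeas cF; have [mo _] := bcont_bmeas omega_bcont.
under eq_fun do rewrite -exprVn -powR_inv1 ?omega_ge0//.
apply: measurable_funM => //; apply: measurable_funX.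
exact: (measurableT_comp (measurable_powR _) mo).
Qed.

Lemma weighted_ge0 F p x : 0 <= F x -> 0 <= F x * (omega x) ^- p.
Proof. by move=> F0; rewrite mulr_ge0// invr_ge0 exprn_ge0// omega_ge0. Qed.

Lemma vreg_le (a b : R) x : 0 < a -> a <= b -> b < 1 -> vreg b x <= vreg a x.
Proof.
move=> a0 ab b1; rewrite /vreg lef_pV2 ?posrE.
- by have := omega_le x; rewrite /wreg; nra.
- by apply: wreg_gt0 => //; exact: lt_le_trans ab.
- by apply: wreg_gt0 => //; exact: le_lt_trans b1.
Qed.

Lemma regularised_le F p (del : R) : 0 < del -> del < 1 -> bcont F ->
  (forall x, 0 <= F x) ->
  ((cint (fun x => F x * vreg del x ^+ p))%:E <=
   cube_integral (fun x => (F x * (omega x) ^- p)%:E))%E.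
Proof.
move=> l0 l1 cF F0.
have cFV : bcont (fun x => F x * vreg del x ^+ p) by apply: bcontM => //;
  apply: bcontX; exact: bcont_vreg.
rewrite -cube_integralE// /cube_integral tuple_row_cube.
have [N [mN N0 NP]] := axis_null.
apply: ae_ge0_le_integral => //.
- by move=> t _; rewrite lee_fin mulr_ge0// exprn_ge0// ltW// vreg_gt0.
- by apply/measurable_EFinP; apply: measurable_funTS; have [] := bcont_bmeas cFV.
- by move=> t _; rewrite lee_fin weighted_ge0.
- exact: measurable_weighted.
exists N; split => // t /=; apply: contra_notP => nNt bt.
have V0 := vreg_gt0 l0 l1 d0 (tr t).
rewrite lee_fin ler_wpM2l// -exprVn lerXn2r ?nnegrE ?(ltW V0)//.
  by rewrite invr_ge0 omega_ge0.
have om0 : 0 < omega (tr t).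
  apply: omega_gt0; first by rewrite -tuple_row_cube in bt.
  by have [i ti] := NP _ nNt; exists i; rewrite mxE.
by rewrite /vreg lef_pV2 ?posrE// ?omega_le_wreg// wreg_gt0.
Qed.

(** Monotone convergence along del = 1 / (n + 2). Where omega vanishes, the limit
only increases the integrand. *)
Lemma weighted_le F p (K : \bar R) : bcont F -> (forall x, 0 <= F x) ->
  (forall del, 0 < del -> del < 1 -> ((cint (fun x => F x * vreg del x ^+ p))%:E
    <= K)%E) ->
  (cube_integral (fun x => (F x * (omega x) ^- p)%:E) <= K)%E.
Proof.
move=> cF F0 hK.
pose del n : R := n.+2%:R^-1.
have l0 n : 0 < del n by rewrite invr_gt0.
have l1 n : del n < 1 by rewrite invf_lt1// ltr1n.
pose g n (t : d.-tuple mR) : \bar R := (F (tr t) * vreg (del n) (tr t) ^+ p)%:E.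
have cFV n : bcont (fun x => F x * vreg (del n) x ^+ p).
  by apply: bcontM => //; apply: bcontX; exact: bcont_vreg.
have mg n : measurable_fun (box d) (g n).
  by apply/measurable_EFinP; apply: measurable_funTS;
    have [] := bcont_bmeas (cFV n).
have g0 n t : box d t -> (0 <= g n t)%E.
  by move=> _; rewrite lee_fin mulr_ge0// exprn_ge0// ltW// vreg_gt0.
have ndg t : box d t -> nondecreasing_seq (g ^~ t).
  have V0 k := ltW (vreg_gt0 (l0 k) (l1 k) d0 (tr t)).
  move=> _ m n mn; rewrite lee_fin ler_wpM2l// lerXn2r ?nnegrE ?V0//.
  apply: vreg_le => //; rewrite lef_pV2 ?posrE// ler_nat; exact: mn.
have bound : (\int[lebesgue_tuple R d]_(t in box d) limn (g ^~ t) <= K)%E.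
  rewrite monotone_convergence//.
  apply: lime_le.
    apply: ereal_nondecreasing_is_cvgn => m n mn.
    by apply: ge0_le_integral => // t bt; [exact: g0|exact: ndg].
  apply: nearW => n; apply: le_trans (hK _ (l0 n) (l1 n)).
  by rewrite -cube_integralE// /cube_integral tuple_row_cube.
apply: le_trans bound; rewrite /cube_integral tuple_row_cube.
have cvg_g t : box d t -> cvgn (g ^~ t).
  by move=> bt; apply: ereal_nondecreasing_is_cvgn; exact: ndg.
apply: ge0_le_integral => //.
- by move=> t _; rewrite lee_fin weighted_ge0.
- exact: measurable_weighted.
- apply: emeasurable_fun_cvg mg _ => t bt; exact: cvg_g.
move=> t bt; have [om0|om0] := eqVneq (omega (tr t)) 0.
  apply: lime_ge; first exact: cvg_g.
  apply: nearW => n; have V0 := ltW (vreg_gt0 (l0 n) (l1 n) d0 (tr t)).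
  by rewrite lee_fin ler_wpM2l// om0 -exprVn invr0 lerXn2r ?nnegrE ?V0.
have op : 0 < omega (tr t) by rewrite lt_def om0 omega_ge0.
suff -> : limn (g ^~ t) = (F (tr t) * omega (tr t) ^- p)%:E by [].
apply/cvg_lim => //; apply: cvg_EFin; first exact: nearW.
have dl : del @ \oo --> (0 : R).
  exact: (cvg_comp (addn 1) _ (@cvg_addnl 1) (@cvg_harmonic R)).
have WW : (fun n => wreg (del n) (tr t)) @ \oo --> omega (tr t).
  rewrite -[X in _ --> X](_ : (1 - 0) * omega (tr t) + 0 * d%:R = _); last by ring.
  apply: cvgD; apply: cvgM; [|exact: cvg_cst|exact: dl|exact: cvg_cst].
  by apply: cvgB => //; exact: cvg_cst.
rewrite -exprVn; apply: (@cvgM _ _ _ _ (fun=> F (tr t))); first exact: cvg_cst.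
apply: (cvg_comp (fun n => vreg (del n) (tr t)) (fun s => s ^+ p));
  last exact: exprn_continuous.
exact: cvgV.
Qed.

Lemma limit_ineq F G p n (C : R) : bcont F -> bcont G ->
  (forall x, 0 <= F x) -> (forall x, 0 <= G x) -> 0 <= C ->
  (forall del, 0 < del -> del < 1 ->
    C * cint (fun x => F x * vreg del x ^+ p) <= cint (fun x => G x * vreg del x
      ^+ n)) ->
  (C%:E * cube_integral (fun x => (F x * (omega x) ^- p)%:E) <=
    cube_integral (fun x => (G x * (omega x) ^- n)%:E))%E.
Proof.
move=> cF cG F0 G0 C0 h.
have [->|Cn0] := eqVneq C 0.
  rewrite mul0e; apply: integral_ge0 => t _; exact: weighted_ge0.
have Cp : 0 < C by rewrite lt_def Cn0.
rewrite -lee_pdivlMl//; apply: weighted_le => // del l0 l1.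
rewrite lee_pdivlMl// -EFinM; apply: le_trans (regularised_le n l0 l1 cG G0).
by rewrite lee_fin h.
Qed.

End Limit.

(** * From smooth periodic functions to jets *)

Section SmoothJets.
Context {R : realType} {d : nat}.
Local Notation rV := 'rV[R]_d.
Implicit Types (x : rV) (i j : 'I_d) (u g : rV -> R).

Definition clamp x : rV := \row_j Num.max (- pi) (Num.min (x 0 j) pi).

Lemma clamp_closed x : closed_cube (clamp x).
Proof.
move=> j; rewrite mxE le_max lexx /= ge_max ge_min lexx orbT andbT.
by rewrite (le_trans (y := 0)) ?oppr_le0 ?pi_ge0.
Qed.

Lemma clamp_id x : closed_cube x -> clamp x = x.
Proof.
move=> cx; apply/rowP => j; rewrite mxE; have /andP[x1 x2] := cx j.
by rewrite (min_idPl x2) (max_idPr x1).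
Qed.

Lemma clamp_continuous : continuous clamp.
Proof.
move=> x A /nbhs_ballP[e /= e0 eA].
have H : nbhs x (ball x e) := nbhsx_ballx x e e0.
apply: (filterS _ H) => y [_ xy] /=; apply: eA; split => // a0 j; rewrite !mxE.
have := xy 0 j; rewrite /ball/= => h; apply: le_lt_trans h.
set a := x 0 j; set b := y 0 j; have pi0 := pi_gt0 R.
have clampP (s : R) : let c := Num.max (- pi) (Num.min s pi) in
    (s <= - pi /\ c = - pi) \/ (- pi <= s <= pi /\ c = s) \/ (pi <= s /\ c = pi).
  have [h1|h1] := leP s pi; last first.
    by right; right; split; [exact: ltW|rewrite /= max_r//; lra].
  have [h2|h2] := leP (- pi) s.
    by right; left.
  by left; split => //; exact: ltW.
have := ler_norm (a - b); have := ler_norm (- (a - b)); rewrite normrN => n1 n2.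
rewrite ler_norml.
by case: (clampP a) => [[? ->]|[[/andP[? ?] ->]|[? ->]]];
  case: (clampP b) => [[? ->]|[[/andP[? ?] ->]|[? ->]]]; apply/andP; split; lra.
Qed.

Lemma closed_cube_compact : compact (@closed_cube R d).
Proof.
have := @rV_compact R d (fun=> `[- pi, pi]%classic) (fun=> @segment_compact _ _ _).
congr compact; apply/seteqP; split => x h i; have := h i; by rewrite /= in_itv.
Qed.

Lemma clamp_bcont g : {within closed_cube, continuous g} -> bcont (g \o clamp).
Proof.
move=> cg; split.
  move=> x; apply: (@cvg_comp _ _ _ clamp g (nbhs x) (within closed_cube (nbhs
    (clamp x)))).
    move=> A wA; have H : nbhs x [set y | closed_cube (clamp y) -> A (clamp y)].
      exact: (@clamp_continuous x _ wA).
    by apply: (filterS _ H) => y /=; apply; exact: clamp_closed.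
  by move/subspace_continuousP : cg; apply; exact: clamp_closed.
have /compact_bounded [M [_ MP]] := continuous_compact cg closed_cube_compact.
exists (`|M| + 1) => x; apply: MP; first by rewrite ltr_pwDr// ler_norm.
by exists (clamp x) => //; exact: clamp_closed.
Qed.

Lemma cube_nbhs x : cube x -> \forall y \near x, cube y.
Proof.
move=> cx; have Fx : Filter (nbhs x) := nbhs_filter x.
apply: (@filter_forall rV 'I_d (fun i => [set y : rV | - pi < y 0 i < pi]) (nbhs
  x) Fx).
move=> i; have cc : {for x, continuous (fun y : rV => y 0 i)} by exact:
  coord_continuous.
have xi : nbhs (x 0 i) [set s : R | - pi < s < pi].
  have : x 0 i \in `]- pi, pi[ by rewrite in_itv/=; exact: cx.
  by move=> /near_in_itvoo; apply: filterS => s; rewrite in_itv.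
exact: (cc _ xi).
Qed.

Lemma set_coord_closed x i (s : R) : closed_cube x -> - pi <= s <= pi ->
  closed_cube (set_coord x i s).
Proof. by move=> cx hs j; rewrite mxE; case: eqP => // _; exact: cx. Qed.

(** Extend each derivative continuously to the closed cube and then to the whole
space by clamping; inside the cube nothing has changed, so the partial
derivatives are still those of u. *)
Lemma smooth_jet u : smooth_closed_cube u -> periodic_derivatives u ->
  exists U : seq 'I_d -> rV -> R, jet U /\
    (forall w x, cube x -> U w x = iter_partial w u x).
Proof.
move=> [_ su] pu.
have [g gP] := choice (fun w => (su w).2).
pose U w := g w \o clamp.
have UE w x : cube x -> U w x = iter_partial w u x.
  move=> cx; rewrite /U /= clamp_id; last exact: cube_closed.
  by have [_ +] := gP w; apply; rewrite inE.
exists U; split => // w i; split.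
- by apply: clamp_bcont; case: (gP w).
- by apply: clamp_bcont; case: (gP (i :: w)).
- move=> j x cx; have pi0 := pi_gt0 R.
  rewrite /U /= !clamp_id; [exact: (pu w _ (gP w))|..];
  apply: set_coord_closed => //; apply/andP; split; lra.
move=> x cx; apply: (@near_eq_is_derive _ _ _ (iter_partial w u)).
  by apply: filterS (cube_nbhs cx) => y cy; rewrite UE.
rewrite UE//; split; last by [].
by have [+ _] := su w; apply.
Qed.

Lemma partial_jet (U : seq 'I_d -> rV -> R) w i g x : jet U ->
  (forall y, cube y -> g y = U w y) -> cube x -> partial i g x = U (i :: w) x.
Proof.
move=> jU gU cx; have [_ _ _ h] := jU w i; have dx := h x cx.
have := @near_eq_is_derive _ _ _ (U w) g x (delta_mx 0 i) (U (i :: w) x) _ dx.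
case; first by apply: filterS (cube_nbhs cx) => y cy; rewrite gU.
by [].
Qed.

Local Open Scope complex_scope.

Lemma Re_sum (f : 'I_d -> R[i]) :
  complex.Re (\sum_i f i) = \sum_i complex.Re (f i).
Proof.
by apply: (big_ind2 (fun (z : R[i]) (r : R) => complex.Re z = r)) => // -[a b] r1
  [a' b'] r2 /= -> ->.
Qed.

Lemma Im_sum (f : 'I_d -> R[i]) :
  complex.Im (\sum_i f i) = \sum_i complex.Im (f i).
Proof.
by apply: (big_ind2 (fun (z : R[i]) (r : R) => complex.Im z = r)) => // -[a b] r1
  [a' b'] r2 /= -> ->.
Qed.

Lemma sqmodE (z : R[i]) : sqmod z = complex.Re z ^+ 2 + complex.Im z ^+ 2.
Proof. by case: z => a b; rewrite /sqmod /= sqr_sqrtr// addr_ge0// sqr_ge0. Qed.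

Definition represents (f : rV -> R[i]) (U U' : seq 'I_d -> rV -> R) : Prop :=
  forall x, cube x -> complex.Re (f x) = U [::] x /\ complex.Im (f x) = U' [::] x.

Lemma represents_laplacian f U U' : jet U -> jet U' -> represents f U U' ->
  represents (laplacian f) (lapJ U) (lapJ U').
Proof.
move=> jU jU' fU x cx; rewrite /laplacian Re_sum Im_sum.
split; apply: eq_bigr => i _ /=.
  apply: (@partial_jet U [:: i]) => // y cy.
  by apply: (@partial_jet U [::]) => // z cz; case: (fU z cz).
apply: (@partial_jet U' [:: i]) => // y cy.
by apply: (@partial_jet U' [::]) => // z cz; case: (fU z cz).
Qed.

Lemma represents_iter f U U' m : jet U -> jet U' -> represents f U U' ->
  represents (iter_laplacian m f) (iter m lapJ U) (iter m lapJ U').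
Proof.
move=> jU jU' fU; elim: m => //= m IH.
by apply: represents_laplacian => //; exact: jet_iter_lap.
Qed.

Lemma represents_sqmod f U U' x : represents f U U' -> cube x ->
  sqmod (f x) = U [::] x ^+ 2 + U' [::] x ^+ 2.
Proof. by move=> fU cx; rewrite sqmodE; have [-> ->] := fU x cx. Qed.

Lemma represents_gradient f U U' x : jet U -> jet U' -> represents f U U' ->
  cube x ->
  sqmod_gradient f x = \sum_i (U [:: i] x ^+ 2 + U' [:: i] x ^+ 2).
Proof.
move=> jU jU' fU cx; apply: eq_bigr => i _; rewrite sqmodE /=.
congr (_ ^+ 2 + _ ^+ 2).
  by apply: (@partial_jet U [::]) => // z cz; case: (fU z cz).
by apply: (@partial_jet U' [::]) => // z cz; case: (fU z cz).
Qed.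

Lemma eq_cube_integral (F G : rV -> \bar R) : (forall x, cube x -> F x = G x) ->
  cube_integral F = cube_integral G.
Proof. by move=> FG; apply: eq_integral => t; rewrite inE; exact: FG. Qed.

End SmoothJets.

(** Real and imaginary parts satisfy the same inequality, which is additive in
the squares; both are added before the passage to the limit. *)
Lemma cube_sum_ineq (R : realType) (d : nat) (hd : (0 < d)%N) (T : Type)
  (r : seq T) (f f' : 'rV[R]_d -> R) (g g' : T -> 'rV[R]_d -> R) (p n : nat) (C :
    R) :
  bcont f -> bcont f' -> (forall k, bcont (g k)) -> (forall k, bcont (g' k)) -> 0
    <= C ->
  (forall del, 0 < del -> del < 1 ->
     C * mass del f p <= \sum_(k <- r) mass del (g k) n) ->
  (forall del, 0 < del -> del < 1 ->
     C * mass del f' p <= \sum_(k <- r) mass del (g' k) n) ->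
  (C%:E * cube_integral (fun x => ((f x ^+ 2 + f' x ^+ 2) * omega x ^- p)%:E) <=
   cube_integral (fun x =>
     ((\sum_(k <- r) (g k x ^+ 2 + g' k x ^+ 2)) * omega x ^- n)%:E))%E.
Proof.
move=> cf cf' cg cg' C0 h h'.
have cV (del : R) q (l0 : 0 < del) (l1 : del < 1) : bcont (fun x : 'rV[R]_d =>
  vreg del x ^+ q).
  by apply: bcontX; exact: bcont_vreg.
apply: (@limit_ineq R d hd (fun x => f x ^+ 2 + f' x ^+ 2)
   (fun x => \sum_(k <- r) (g k x ^+ 2 + g' k x ^+ 2))) => //.
- by apply: bcontD; exact: bcontX.
- by apply: bcont_sum => k; apply: bcontD; exact: bcontX.
- by move=> x; rewrite addr_ge0// sqr_ge0.
- by move=> x; apply: sumr_ge0 => k _; rewrite addr_ge0// sqr_ge0.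
move=> del l0 l1.
have cm (F : 'rV[R]_d -> R) q : bcont F -> bcont (fun x => F x ^+ 2 * vreg del x
  ^+ q).
  by move=> cF; apply: bcontM; [exact: bcontX|exact: cV].
have -> : cint (fun x => (f x ^+ 2 + f' x ^+ 2) * vreg del x ^+ p) =
    mass del f p + mass del f' p.
  rewrite -cintD; [|exact: cm|exact: cm].
  by congr cint; apply/funext => x; rewrite mulrDl.
have -> : cint (fun x => (\sum_(k <- r) (g k x ^+ 2 + g' k x ^+ 2)) * vreg del x
  ^+ n) =
    \sum_(k <- r) mass del (g k) n + \sum_(k <- r) mass del (g' k) n.
  rewrite -big_split /= (eq_bigr (fun k => cint (fun x => g k x ^+ 2 * vreg del x
    ^+ n +
     g' k x ^+ 2 * vreg del x ^+ n))); last first.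
    by move=> k _; rewrite -cintD; [|exact: cm|exact: cm].
  rewrite -cint_sum; last by move=> k; apply: bcontD; exact: cm.
  congr cint; apply/funext => x; rewrite mulr_suml; apply: eq_bigr => k _.
  by rewrite mulrDl.
by rewrite mulrDr lerD ?h ?h'.
Qed.

Theorem theorem3p11 (R : realType) (d : nat) (hd : (1 <= d)%N)
  (psi : 'rV[R]_d -> R[i])
  (psi_smooth_Re : smooth_closed_cube (fun x => complex.Re (psi x)))
  (psi_smooth_Im : smooth_closed_cube (fun x => complex.Im (psi x)))
  (psi_periodic_Re : periodic_derivatives (fun x => complex.Re (psi x)))
  (psi_periodic_Im : periodic_derivatives (fun x => complex.Im (psi x)))
  (psi_average : cube_integralC psi = 0)
  (k : int) (hk : k <= 0) (m : nat) :
  (- 2 * k + 4 * m%:Z < d%:Z ->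
    ((C_even R m k d)%:E *
       cube_integral (fun x => (sqmod (psi x) * omega x ^ (k - 2 * m%:Z))%:E)
     <= cube_integral
          (fun x => (sqmod (iter_laplacian m psi x) * omega x ^ k)%:E))%E)
  /\
  (- 2 * k + 4 * m%:Z + 2 < d%:Z ->
    ((C_odd R m k d)%:E *
       cube_integral
         (fun x => (sqmod (psi x) * omega x ^ (k - (2 * m%:Z + 1)))%:E)
     <= cube_integral
          (fun x => (sqmod_gradient (iter_laplacian m psi) x * omega x ^ k)%:E))%E).
Proof.
have [U [jU UE]] := smooth_jet psi_smooth_Re psi_periodic_Re.
have [U' [jU' U'E]] := smooth_jet psi_smooth_Im psi_periodic_Im.
have fU : represents psi U U' by move=> x cx; rewrite UE// U'E.
have jL := jet_iter_lap m jU; have jL' := jet_iter_lap m jU'.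
have fL := represents_iter m jU jU' fU.
have [U0 U'0] : cint (U [::]) = 0 /\ cint (U' [::]) = 0.
  move: psi_average; rewrite /cube_integralC tuple_row_cube => -[ra ia].
  split.
    by rewrite -[RHS]ra; apply: (@eq_cint _ _ (U [::]) (fun x => complex.Re (psi
      x))) => x cx; rewrite UE.
  by rewrite -[RHS]ia; apply: (@eq_cint _ _ (U' [::]) (fun x => complex.Im (psi
    x))) => x cx; rewrite U'E.
have [n kn] : exists n : nat, k = - n%:Z by exists `|k|%N; lia.
have expN (x : 'rV[R]_d) (q : nat) (l : int) : l = - q%:Z -> omega x ^ l = omega
  x ^- q.
  by move=> ->; rewrite -exprnN.
split => hkd.
- have hd' : (2 * n + 4 * m < d)%N by lia.
  rewrite (@eq_cube_integral _ _ _ (fun x => ((U [::] x ^+ 2 + U' [::] x ^+ 2) *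
    omega x ^- (n + 2 * m))%:E)); last first.
    by move=> x cx; rewrite (represents_sqmod fU)// (expN _ (n + 2 * m)%N)//; lia.
  rewrite [leRHS](@eq_cube_integral _ _ _ (fun x => ((\sum_(i <- [:: tt])
     (iter m lapJ U [::] x ^+ 2 + iter m lapJ U' [::] x ^+ 2)) * omega x ^-
       n)%:E)); last first.
    by move=> x cx; rewrite big_seq1 (represents_sqmod fL)// (expN _ n).
  apply: cube_sum_ineq => //.
  + exact: (jet_bcont hd).
  + exact: (jet_bcont hd).
  + by move=> _; exact: (jet_bcont hd).
  + by move=> _; exact: (jet_bcont hd).
  + by rewrite kn; have [] := even_ineq hd (ltac:(lra) : 0 < 2^-1 :> R)
    (ltac:(lra) : 2^-1 < 1 :> R) hd' jU U0.
  + by move=> del l0 l1; rewrite big_seq1 kn;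
    have [] := even_ineq hd l0 l1 hd' jU U0.
  + by move=> del l0 l1; rewrite big_seq1 kn;
    have [] := even_ineq hd l0 l1 hd' jU' U'0.
- have hd' : (2 * n + 4 * m + 2 < d)%N by lia.
  rewrite (@eq_cube_integral _ _ _ (fun x => ((U [::] x ^+ 2 + U' [::] x ^+ 2) *
    omega x ^- (n + 2 * m + 1))%:E)); last first.
    by move=> x cx; rewrite (represents_sqmod fU)// (expN _ (n + 2 * m + 1)%N)//;
      lia.
  rewrite [leRHS](@eq_cube_integral _ _ _ (fun x => ((\sum_(i < d)
     (iter m lapJ U [:: i] x ^+ 2 + iter m lapJ U' [:: i] x ^+ 2)) * omega x ^-
       n)%:E)); last first.
    by move=> x cx; rewrite (represents_gradient jL jL' fL)// (expN _ n).
  apply: cube_sum_ineq => //.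
  + exact: (jet_bcont hd).
  + exact: (jet_bcont hd).
  + by move=> i; exact: (jet_bcont hd).
  + by move=> i; exact: (jet_bcont hd).
  + by rewrite kn; have [] := odd_ineq hd (ltac:(lra) : 0 < 2^-1 :> R)
    (ltac:(lra) : 2^-1 < 1 :> R) hd' jU U0.
  + by move=> del l0 l1; rewrite kn; have [] := odd_ineq hd l0 l1 hd' jU U0.
  + by move=> del l0 l1; rewrite kn; have [] := odd_ineq hd l0 l1 hd' jU' U'0.
Qed.
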